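(* With notation as in the context, $\mathbb M=\widetilde{\mathbb M}_1$; that is, for $g\in\mathbb G$, the function $\phi(g;\cdot)$ has a nondegenerate critical point in $\Omega_*$ if and only if the set of global maximizers of $\phi(g;\cdot)$ in $\Omega_*$ consists of exactly one point.
   Context: Let $q,m\ge1$, $U^{(1)},\dots,U^{(m)}$ linearly independent real skew-symmetric $q\times q$ matrices, $\mathbb G=\mathbb R^q\times\mathbb R^m$. $U(\tau)=i\sum_j\tau_jU^{(j)}$, $\Omega_*=\{\tau\in\mathbb R^m:\|U(\tau)\|<\pi\}$ (operator norm), and for $g=(x,t)$, $\phi(g;\tau)=\langle U(\tau)\cot U(\tau)x,x\rangle+4t\cdot\tau$, $\tau\in\Omega_*$ (a smooth concave function). $\mathbb M=\{g:\ \exists\theta\in\Omega_*$ with $\nabla_\tau\phi(g;\theta)=0$ and $\det\mathrm{Hess}_\tau\phi(g;\theta)\neq0\}$. $\widetilde{\mathbb M}_1=\{g:$ the set of global maximizers of $\phi(g;\cdot)$ in $\Omega_*$ is a singleton$\}$. *)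

(* Defs.v *)
From HB Require Import structures.
From mathcomp Require Import all_boot all_order all_algebra.
From mathcomp Require Import all_classical all_reals all_analysis.
Set Implicit Arguments. Unset Strict Implicit. Unset Printing Implicit Defensive.
Import Order.TTheory GRing.Theory Num.Theory.
Import numFieldNormedType.Exports.
Local Open Scope classical_set_scope.
Local Open Scope ring_scope.

Section Defs.
Variable R : realType.

(* Taylor coefficients of  z cot z = \sum_k cotc k * z^(2k)  (|z| < pi),
   determined by  (z cot z) * (sin z / z) = cos z, i.e.
   \sum_(j <= k) cotc j * sinc_c (k - j) = cos_c k,  with sinc_c 0 = 1. *)
Definition sinc_c (k : nat) : R := (-1) ^+ k / (k.*2.+1)`!%:R.
Definition cos_c (k : nat) : R := (-1) ^+ k / (k.*2)`!%:R.

Fixpoint cotc_seq (n : nat) : seq R :=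
  match n with
  | 0 => [:: 1]
  | n'.+1 => let s := cotc_seq n' in
             rcons s (cos_c n - \sum_(j < n) nth 0 s j * sinc_c (n - j))
  end.

Definition cotc (k : nat) : R := nth 0 (cotc_seq k) k.

Definition vnorm (n : nat) (x : 'cV[R]_n) : R := Num.sqrt (\sum_i x i 0 ^+ 2).

Definition opnorm (n : nat) (A : 'M[R]_n) : R :=
  sup [set vnorm (A *m x) | x in [set x : 'cV[R]_n | vnorm x <= 1]].

(* A(tau) = \sum_j tau_j U^(j) (real skew-symmetric); U(tau) = i A(tau). *)
Definition Amat (q m : nat) (U : 'I_m -> 'M[R]_q) (tau : 'rV[R]_m) : 'M[R]_q :=
  \sum_j tau 0 j *: U j.

(* U(tau) cot U(tau) = \sum_k cotc k * (U(tau)^2)^k, with U(tau)^2 = - A(tau)^2;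
   the power series converges since ||U(tau)|| < pi on Omega_*. *)
Definition UcotU (q m : nat) (U : 'I_m -> 'M[R]_q) (tau : 'rV[R]_m) : 'M[R]_q :=
  \matrix_(i, j) limn (fun N => \sum_(k < N)
      cotc k * ((- (Amat U tau *m Amat U tau)) ^+ k) i j).

(* Omega_* = { tau : ||U(tau)|| < pi };  ||U(tau)|| = ||A(tau)||. *)
Definition Omega (q m : nat) (U : 'I_m -> 'M[R]_q) : set 'rV[R]_m :=
  [set tau | opnorm (Amat U tau) < pi].

Definition phi (q m : nat) (U : 'I_m -> 'M[R]_q) (x : 'cV[R]_q) (t : 'rV[R]_m)
    (tau : 'rV[R]_m) : R :=
  (x^T *m UcotU U tau *m x) 0 0 + 4 * \sum_j t 0 j * tau 0 j.

Definition ej (m : nat) (j : 'I_m) : 'rV[R]_m := delta_mx 0 j.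

Definition pderiv (m : nat) (f : 'rV[R]_m -> R) (j : 'I_m) : 'rV[R]_m -> R :=
  fun tau => derive f tau (ej j).

Definition grad_zero (m : nat) (f : 'rV[R]_m -> R) (th : 'rV[R]_m) : Prop :=
  forall j, pderiv f j th = 0.

Definition hessian (m : nat) (f : 'rV[R]_m -> R) (th : 'rV[R]_m) : 'M[R]_m :=
  \matrix_(i, j) pderiv (pderiv f j) i th.

Definition inM (q m : nat) (U : 'I_m -> 'M[R]_q) (x : 'cV[R]_q) (t : 'rV[R]_m) : Prop :=
  exists2 th, Omega U th &
    grad_zero (phi U x t) th /\ \det (hessian (phi U x t) th) != 0.

Definition maximizers (q m : nat) (U : 'I_m -> 'M[R]_q) (x : 'cV[R]_q) (t : 'rV[R]_m)
  : set 'rV[R]_m :=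
  [set th | Omega U th /\ forall tau, Omega U tau -> phi U x t tau <= phi U x t th].

Definition inM1 (q m : nat) (U : 'I_m -> 'M[R]_q) (x : 'cV[R]_q) (t : 'rV[R]_m) : Prop :=
  exists th, maximizers U x t = [set th].

End Defs.

(* Main.v *)
(** Write [S = - A(tau)^2], [c_n = n pi] and [s_k = |A(tau)^k x|^2].  Newton's
identities for the polynomial with roots [tan^2 (n pi / N)], in the limit of
large [N], give [- cotc k = \sum_n 2 c_n^(-2k)] for [k >= 1], so that
[phi (x, t; tau) = |x|^2 - \sum_n 2 (g_n - |x|^2) + 4 t.tau] with
[g_n = <(1 - S / c_n^2)^-1 x, x>].  Each [g_n] is [c_n <(c_n + J)^-1 X, X>], where
[X = (x, 0)] and [J] is the real form of [i A(tau)], a symmetric matrix that is linear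
in [tau].  The variational formula for the resolvent gives
[g_n(tau + h) + g_n(tau - h) - 2 g_n(tau) >= |J(h) y_n|^2] with
[y_n = (c_n + J(tau))^-1 X].  Hence [phi] is concave, and a direction [v] with
vanishing second derivative has [J(v) y_n = 0] for all [n]; then
[(c_n + J(tau + s v)) y_n = X], so every [g_n] is constant, and [phi] affine, along
[v].  A maximizer with degenerate Hessian is therefore not unique; conversely [phi] is
constant on the segment between two maximizers, which forces a degenerate Hessian.
The derivatives are read off from a Taylor expansion of [phi] whose cubic error is
uniform in the base point. *)

Require Import Defs.
From HB Require Import structures.
From mathcomp Require Import all_boot all_order all_algebra.
From mathcomp Require Import all_classical all_reals all_analysis.
From mathcomp Require Import ring lra.
Set Implicit Arguments. Unset Strict Implicit. Unset Printing Implicit Defensive.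
Import Order.TTheory GRing.Theory Num.Theory.
Import numFieldNormedType.Exports.
Local Open Scope classical_set_scope.
Local Open Scope ring_scope.

(** * Newton's identities for the inverse roots of a polynomial *)

(** This compares coefficients in $p' = p \cdot (p'/p)$, where $p'/p = -\sum_r \sum_k r^{-k-1} X^k$.
    The induction adjoins one linear factor at a time, which avoids power series. *)
Lemma newton_coef_prod (F : fieldType) (c : F) (rs : seq F) (k : nat) :
  0 \notin rs ->
  let p : {poly F} := c *: \prod_(r <- rs) ('X - r%:P) in
  \sum_(j < k.+1) (\sum_(r <- rs) r ^- (k.+1 - j)) * p`_j = - (k.+1%:R * p`_k.+1).
Proof.
elim: rs k => [|r rs IH] k; rewrite ?inE ?negb_or.
  move=> _ /=; rewrite big_nil alg_polyC coefC mulr0 oppr0 big1// => j _.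
  by rewrite big_nil mul0r.
case/andP; rewrite eq_sym => r0 rs0 /=; rewrite big_cons.
set p : {poly F} := c *: \prod_(r <- rs) ('X - r%:P).
have -> : c *: (('X - r%:P) * \prod_(r <- rs) ('X - r%:P)) = p * 'X - r *: p.
  by rewrite scalerAr -/p mulrBl commr_polyX mul_polyC.
have IHp n : \sum_(j < n) (\sum_(r <- rs) r ^- (n - j)) * p`_j = - (n%:R * p`_n).
  by case: n => [|n]; [rewrite big_ord0 mul0r oppr0 | exact: IH].
clearbody p.
(* The share of the new root [r] in the power sums, paired with the coefficients of $p\,(X - r)$,
   telescopes. *)
have tele : \sum_(i < k.+1) r ^- (k.+1 - i) *
     ((if i == 0%N :> nat then 0 else p`_i.-1) - r * p`_i) = - p`_k.
  pose f i := r ^- (k.+1 - i) * (if i is i'.+1 then p`_i' else 0).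
  rewrite (eq_bigr (fun i : 'I_k.+1 => - (f i.+1 - f i))).
    rewrite sumrN -(big_mkord xpredT (fun i => f i.+1 - f i)) telescope_sumr//.
    by rewrite /f subnn expr0 invr1 mul1r mulr0 subr0.
  case=> i /= ik _; rewrite /f subSS opprB mulrBr; congr (_ - _).
    by case: i ik => [|i] ik.
  by rewrite mulrA subSn// exprSr invfM divfK.
rewrite (eq_bigr (fun i : 'I_k.+1 =>
    r ^- (k.+1 - i) * ((if i == 0%N :> nat then 0 else p`_i.-1) - r * p`_i) +
    ((\sum_(z <- rs) z ^- (k.+1 - i)) * (if i == 0%N :> nat then 0 else p`_i.-1) -
     r * ((\sum_(z <- rs) z ^- (k.+1 - i)) * p`_i)))); last first.
  move=> i _; rewrite big_cons coefB coefMX coefZ.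
  by rewrite mulrDl; congr (_ + _); rewrite mulrBr mulrCA.
rewrite big_split /= tele sumrB -mulr_sumr IHp big_ord_recl /= mulr0 add0r.
under eq_bigr do rewrite /bump /= add1n subSS.
by rewrite IHp coefB coefMX coefZ /= -natr1; ring.
Qed.

(** * The expansion of the cotangent *)

Section TanPolynomials.
Variable R : realType.

Definition sin_poly (N : nat) : {poly R} := \poly_(k < N) ((-1) ^+ k * 'C(N, k.*2.+1)%:R).
Definition cos_poly (N : nat) : {poly R} := \poly_(k < N.+1) ((-1) ^+ k * 'C(N, k.*2)%:R).

Lemma coef_sin_poly N k : (sin_poly N)`_k = (-1) ^+ k * 'C(N, k.*2.+1)%:R.
Proof.
rewrite coef_poly; case: ltnP => // Nk; rewrite bin_small ?mulr0//.
by rewrite ltnS (leq_trans Nk)// -addnn leq_addr.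
Qed.

Lemma coef_cos_poly N k : (cos_poly N)`_k = (-1) ^+ k * 'C(N, k.*2)%:R.
Proof.
rewrite coef_poly; case: ltnP => // Nk; rewrite bin_small ?mulr0//.
by rewrite (leq_trans Nk)// -addnn leq_addr.
Qed.

Lemma sin_polyS N : sin_poly N.+1 = sin_poly N + cos_poly N.
Proof.
apply/polyP => k; rewrite coefD !coef_sin_poly coef_cos_poly binS natrD mulrDr.
by rewrite addrC.
Qed.

Lemma cos_polyS N : cos_poly N.+1 = cos_poly N - sin_poly N * 'X.
Proof.
apply/polyP => -[|k]; rewrite coefB coefMX !coef_cos_poly /= ?subr0 ?bin0//.
rewrite coef_sin_poly binS natrD mulrDr; congr (_ + _).
by rewrite exprS mulN1r mulNr.
Qed.

(* [(1 + i t)^N = cos_poly N (t^2) + i t sin_poly N (t^2)] for [t = tan a]. *)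
Lemma de_moivre_tan N (a : R) : cos a != 0 ->
  cos (N%:R * a) = cos a ^+ N * (cos_poly N).[tan a ^+ 2] /\
  sin (N%:R * a) = cos a ^+ N * tan a * (sin_poly N).[tan a ^+ 2].
Proof.
move=> ca; have sE : sin a = cos a * tan a by rewrite /tan mulrC divfK.
move: (tan a) sE => T sE.
elim: N => [|N [IHc IHs]].
  rewrite mul0r cos0 sin0 /cos_poly /sin_poly !poly_def big_ord1 big_ord0.
  by rewrite bin0 expr0 mulr1 scale1r expr0 hornerC horner0 !mulr1 mulr0.
rewrite -natr1 mulrDl mul1r cosD sinD IHc IHs sin_polyS cos_polyS.
rewrite !hornerD hornerN hornerM hornerX sE (exprS (cos a)).
by split; ring.
Qed.

End TanPolynomials.

(** * Limits of the rescaled coefficients and of the tangent nodes *)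

Section CotangentCoefficients.
Variable R : realType.
Implicit Types (M n k : nat).

Lemma cvg_sumr (I : Type) (r : seq I) (T : Type) (F : set_system T) (FF : Filter F)
    (f : I -> T -> R) (l : I -> R) :
  (forall i, f i x @[x --> F] --> l i) ->
  \sum_(i <- r) f i x @[x --> F] --> \sum_(i <- r) l i.
Proof. by move=> fl; apply: cvg_big => //; exact: add_continuous. Qed.

Lemma cvg_exprn (T : Type) (F : set_system T) (FF : Filter F)
    (f : T -> R) (l : R) k :
  f x @[x --> F] --> l -> (f x) ^+ k @[x --> F] --> l ^+ k.
Proof. by move=> fl; apply: (cvg_comp f (fun y => y ^+ k) fl); exact: exprn_continuous. Qed.

Lemma cvg_inv_odd : (M.*2.+1)%:R^-1 @[M --> \oo] --> (0 : R).
Proof.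
apply: (@squeeze_cvgr _ _ _ _ (fun=> 0) (@harmonic R)); last 2 first.
- exact: cvg_cst.
- exact: cvg_harmonic.
near=> M; rewrite invr_ge0 ler0n /= lef_pV2 ?posrE ?ltr0n//.
by rewrite ler_nat ltnS -addnn leq_addr.
Unshelve. all: by end_near. Qed.

Lemma cvg_bin_div k :
  'C(M.*2.+1, k)%:R / (M.*2.+1)%:R ^+ k @[M --> \oo] --> (k`!%:R^-1 : R).
Proof.
elim: k => [|k IH].
  under eq_fun do rewrite bin0 expr0 divr1.
  rewrite fact0 invr1; exact: cvg_cst.
(* The recursion $(k+1)\binom{N}{k+1} = (N-k)\binom{N}{k}$ yields the factor $(1-k/N)/(k+1)$; the
   truncated subtraction is a real one only for $k \le N$, hence eventually. *)
apply: (@cvg_trans _ ((fun M => 'C(M.*2.+1, k)%:R / (M.*2.+1)%:R ^+ k *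
    (1 - k%:R * (M.*2.+1)%:R^-1) * k.+1%:R^-1 : R) @ \oo)).
  apply: near_eq_cvg; near=> M.
  have kM : (k <= M.*2.+1)%N.
    rewrite leqW// -addnn (@leq_trans M) ?leq_addr//.
    by near: M; exact: nbhs_infty_ge.
  have N0 : (M.*2.+1)%:R != 0 :> R by rewrite pnatr_eq0.
  have k0 : k.+1%:R != 0 :> R by rewrite pnatr_eq0.
  have : (k.+1 * 'C(M.*2.+1, k.+1))%:R = ((M.*2.+1 - k) * 'C(M.*2.+1, k))%:R :> R.
    by rewrite mul_bin_left.
  rewrite !natrM natrB// => /(canRL (mulKf k0)) ->.
  have := expf_neq0 k N0; rewrite exprSr.
  move: (_ ^+ k) N0 k0 => P; move: (M.*2.+1%:R) (k.+1%:R) ('C(_, _)%:R) (k%:R).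
  move=> N K C l N0 K0 P0.
  by field; rewrite N0 K0 P0.
have -> : k.+1`!%:R^-1 = k`!%:R^-1 * (1 - k%:R * 0) * k.+1%:R^-1 :> R.
  by rewrite mulr0 subr0 mulr1 factS natrM invfM mulrC.
apply: cvgMr_tmp; apply: cvgM => //; apply: cvgB; first exact: cvg_cst.
by apply: cvgMl_tmp; exact: cvg_inv_odd.
Unshelve. all: by end_near. Qed.

(** With $N = 2M+1$, these are the coefficients of $N^{-1}$ [sin_poly N] evaluated at $z^2/N^2$, a
    polynomial of degree $M$ in $z^2$ that tends to $\sin z / z$ coefficientwise. *)
Definition tan_coef M k : R :=
  (-1) ^+ k * ('C(M.*2.+1, k.*2.+1)%:R / (M.*2.+1)%:R ^+ k.*2.+1).

Lemma cvg_tan_coef k : tan_coef M k @[M --> \oo] --> sinc_c R k.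
Proof. by apply: cvgMl_tmp; exact: cvg_bin_div. Qed.

(** This is $c_{n+1}$ of the overview: the numbering starts at 0, so the zero of the sine at the
    origin is left out. *)
Definition node n : R := n.+1%:R * pi.

Definition tan_node M n : R := (M.*2.+1)%:R * tan (node n / (M.*2.+1)%:R).

Lemma node_gt0 n : 0 < node n.
Proof. by rewrite mulr_gt0 ?pi_gt0. Qed.

Lemma node_half M n : (n < M)%N -> 0 < node n / (M.*2.+1)%:R < pi / 2.
Proof.
move=> nM; rewrite divr_gt0 ?node_gt0//= ltr_pdivrMr//.
rewrite /node mulrAC ltr_pdivlMr// mulrC mulrA [ltRHS]mulrC ltr_pM2r ?pi_gt0//.
by rewrite -natrM ltr_nat mul2n ltnS leq_double.
Qed.

(** Mean value theorem: the derivative $\cos^{-2}$ is at least 1. *)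
Lemma le_tan (x : R) : 0 <= x < pi / 2 -> x <= tan x.
Proof.
case/andP => x0 xpi.
have c0 z : 0 <= z <= x -> 0 < cos z.
  move=> /andP[z0 zx]; apply: cos_gt0_pihalf; rewrite (le_lt_trans zx)// andbT.
  by rewrite (lt_le_trans _ z0)// oppr_lt0 divr_gt0 ?pi_gt0.
have [||z] := @MVT_segment R tan (fun x => (cos x) ^- 2) 0 x x0.
- move=> z /[!in_itv]/= /andP[z0 zx]; apply: is_derive_tan.
  by rewrite gt_eqF// c0// !ltW.
- apply/continuous_in_subspaceT => z /[!(@mem_setE R)] /[!in_itv]/= zI.
  by apply: continuous_tan; rewrite gt_eqF// c0.
rewrite in_itv/= tan0 !subr0 => zI ->.
by rewrite ler_peMl// invf_ge1 ?exprn_gt0 ?c0// exprn_ile1 ?cos_le1// ltW ?c0.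
Qed.

Lemma node_le_tan_node M n : (n < M)%N -> node n <= tan_node M n.
Proof.
move=> nM; rewrite /tan_node mulrC -ler_pdivrMr//; apply: le_tan.
by have /andP[/ltW -> ->] := node_half nM.
Qed.

(** The derivative of the tangent at 0 is 1; the difference quotient is taken along $h = c/N$ for
    the node $c$, which tends to 0 from the right. *)
Lemma cvg_tan_node n : tan_node M n @[M --> \oo] --> node n.
Proof.
have d0 : (h^-1 * tan h) @[h --> (0 : R)^'] --> (1 : R).
  have [] : is_derive (0 : R) (1 : R) tan ((cos 0) ^- 2).
    by apply: is_derive_tan; rewrite cos0 oner_neq0.
  rewrite cos0 expr1n invr1 => /cvg_ex[l tl] dl.
  have e1 : (fun h : R => h^-1 *: (tan (h *: 1 + 0) - tan 0)) =
      (fun h => h^-1 * tan h).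
    by apply/funext => h; rewrite tan0 subr0 addr0 /GRing.scale/= mulr1.
  move: dl tl; rewrite /derive e1 => <- tl.
  by rewrite (cvg_lim _ tl).
move/cvg_dnbhs_at_right/cvg_at_rightP: d0 => d0.
have nN0 M : (M.*2.+1)%:R != 0 :> R by rewrite pnatr_eq0.
rewrite -[node n]mulr1.
have -> : (fun M => tan_node M n) = (fun M => node n *
    ((node n / (M.*2.+1)%:R)^-1 * tan (node n / (M.*2.+1)%:R))).
  apply/funext => M; rewrite /tan_node invfM invrK -[_^-1 * _ * _]mulrA.
  by rewrite mulVKf// lt0r_neq0 ?node_gt0.
apply: cvgMl_tmp; apply: d0; split => [M|]; first by rewrite divr_gt0// node_gt0.
rewrite -[X in _ --> X](mulr0 (node n)).
by apply: cvgMl_tmp; exact: cvg_inv_odd.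
Qed.

End CotangentCoefficients.

(** * Power sums of the nodes and the coefficients of $z \cot z$ *)

Section CotangentExpansion.
Variable R : realType.
Implicit Types (M n k : nat).
Local Notation node := (node R).
Local Notation tan_node := (tan_node R).
Local Notation tan_coef := (tan_coef R).

Lemma sin_natpi n : sin (n%:R * pi) = 0 :> R.
Proof.
by elim: n => [|n IH]; rewrite ?mul0r ?sin0// -natr1 mulrDl mul1r sinDpi IH oppr0.
Qed.

Lemma tan_node_gt0 M n : (n < M)%N -> 0 < tan_node M n.
Proof. by move=> /(node_le_tan_node R); apply: lt_le_trans; exact: node_gt0. Qed.

(** At $a = n\pi/N$ the sine of $Na$ vanishes while $\cos a$ and $\tan a$ are positive, so de
    Moivre's formula makes $\tan^2 a$ a root. This gives $M$ distinct roots in degree $M$. *)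
Lemma sin_poly_tan_node M :
  let tn n : R := tan (node n / (M.*2.+1)%:R) in
  exists c : R, sin_poly R (M.*2.+1) =
    c *: \prod_(r <- [seq tn n ^+ 2 | n <- iota 0 M]) ('X - r%:P).
Proof.
move=> tn; exists (lead_coef (sin_poly R (M.*2.+1))).
have tn_gt0 n : (n < M)%N -> 0 < tn n.
  by move=> nM; rewrite -(@pmulr_rgt0 _ (M.*2.+1)%:R)//; exact: tan_node_gt0.
apply: all_roots_prod_XsubC.
(* The coefficient of index $M$ is $\pm\binom{2M+1}{2M+1}$, so the degree is exactly $M$. *)
- rewrite size_map size_iota; apply/anti_leq/andP; split.
    apply/leq_sizeP => k Mk; rewrite coef_sin_poly bin_small ?mulr0//.
    by rewrite ltnS ltn_double.
  rewrite ltnNge; apply: contraT => /negbNE /leq_sizeP/(_ M (leqnn M)) /eqP.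
  by rewrite coef_sin_poly binn mulr1 signr_eq0.
- apply/allP => z /mapP[n]; rewrite mem_iota add0n => /andP[_ nM] ->.
  have /andP[h0 h1] := node_half R nM; set a := node n / _ in h0 h1.
  have ca : 0 < cos a.
    by apply: cos_gt0_pihalf; rewrite h1 andbT (lt_trans _ h0)// oppr_lt0 divr_gt0 ?pi_gt0.
  have [_] := de_moivre_tan (M.*2.+1) (lt0r_neq0 ca).
  have -> : (M.*2.+1)%:R * a = n.+1%:R * pi by rewrite /a mulrC divfK.
  rewrite sin_natpi => e0; have ta : 0 < tan a := tn_gt0 n nM.
  have c0 : cos a ^+ M.*2.+1 * tan a != 0.
    by apply/lt0r_neq0/mulr_gt0 => //; exact: exprn_gt0.
  by apply/rootP; apply: (mulfI c0); rewrite mulr0 -e0.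
- rewrite uniq_rootsE map_inj_in_uniq ?iota_uniq// => i j.
  rewrite !mem_iota !add0n => /andP[_ iM] /andP[_ jM] /eqP.
  rewrite eqrXn2 ?ltW ?tn_gt0// => /eqP eij.
  have inI n : (n < M)%N -> node n / (M.*2.+1)%:R \in `](- (pi/2)), (pi/2)[.
    move=> nM; have /andP[h0 h1] := node_half R nM.
    by rewrite in_itv/= h1 andbT (lt_trans _ h0)// oppr_lt0 divr_gt0 ?pi_gt0.
  have /(mulIf _) := tan_inj (inI i iM) (inI j jM) eij.
  rewrite invr_eq0 pnatr_eq0 => /(_ isT) /(mulIf _).
  by rewrite gt_eqF ?pi_gt0// => /(_ isT)/eqP; rewrite eqr_nat eqSS => /eqP.
Qed.

(** Dividing Newton's identities for [sin_poly] by $N^{2k+3}$ rescales its roots to the squares of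
    the tangent nodes. *)
Lemma tan_node_newton M k :
  \sum_(j < k.+1) (\sum_(n < M) tan_node M n ^- (k.+1 - j).*2) * tan_coef M j =
  - (k.+1%:R * tan_coef M k.+1).
Proof.
pose tn n : R := tan (node n / (M.*2.+1)%:R).
pose rs := [seq tn n ^+ 2 | n <- iota 0 M].
have [c pE] : exists c : R, sin_poly R (M.*2.+1) = c *: \prod_(r <- rs) ('X - r%:P).
  exact: sin_poly_tan_node.
have rs0 : 0 \notin rs.
  apply/negP => /mapP[n]; rewrite mem_iota add0n => /andP[_ nM] /esym/eqP.
  rewrite sqrf_eq0 gt_eqF// -(@pmulr_rgt0 _ (M.*2.+1)%:R)//; exact: tan_node_gt0.
have := newton_coef_prod c k rs0; rewrite /= -pE.
move=> /(congr1 (fun z => z / (M.*2.+1)%:R ^+ (k.+1).*2.+1)).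
have coefE j : (sin_poly R (M.*2.+1))`_j = tan_coef M j * (M.*2.+1)%:R ^+ j.*2.+1.
  by rewrite coef_sin_poly /tan_coef -mulrA divfK// expf_neq0.
rewrite coefE mulNr mulrA mulfK ?expf_neq0// => <-.
rewrite mulr_suml; apply: eq_bigr => -[j jk] _ /=.
rewrite coefE big_map -[in iota 0 M](subn0 M) big_mkord !mulr_suml.
apply: eq_bigr => n _; rewrite /tan_node -exprM exprMn.
have -> : (k.+1.*2.+1 = (k.+1 - j).*2 + j.*2.+1)%N.
  by rewrite addnS -doubleD subnK// ltnW.
rewrite mul2n exprD -/(tn n) !invfM.
have N0 i : (M.*2.+1)%:R ^+ i != 0 :> R by rewrite expf_neq0.
move: (N0 j.*2.+1); move: (_ ^- _) (_ ^- _) (tan_coef M j) (_ ^+ _) => x y z u u0.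
by field.
Qed.

Lemma size_cotc_seq k : size (cotc_seq R k) = k.+1.
Proof. by elim: k => //= k IH; rewrite size_rcons IH. Qed.

Lemma nth_cotc_seq k j : (j <= k)%N -> nth 0 (cotc_seq R k) j = cotc R j.
Proof.
elim: k => [|k IH]; first by rewrite leqn0 => /eqP ->.
rewrite leq_eqVlt => /predU1P[->//|jk].
by rewrite /= nth_rcons size_cotc_seq jk IH.
Qed.

(** Since $\cos$ is the derivative of $\sin$, [cos_c] at $k+1$ is $2k+3$ times [sinc_c]; moving the
    term of [cotc 0] across leaves $2k+2$. Divided by $-2$, this is [tan_node_newton] in the limit,
    with [- cotc / 2] as the power sums. *)
Lemma cotc_rec k : \sum_(j < k.+1) cotc R (k.+1 - j) * sinc_c R j =
  k.+1.*2%:R * sinc_c R k.+1.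
Proof.
have cE : cotc R k.+1 = cos_c R k.+1 - \sum_(j < k.+1) cotc R j * sinc_c R (k.+1 - j).
  rewrite /cotc /= nth_rcons size_cotc_seq ltnn eqxx; congr (_ - _).
  by apply: eq_bigr => -[j jk] _; rewrite /= nth_cotc_seq.
have s0 : sinc_c R 0 = 1 by exact: divr1.
have cosE : cos_c R k.+1 = k.+1.*2.+1%:R * sinc_c R k.+1.
  by rewrite /cos_c /sinc_c factS natrM invfM mulrCA mulVKf.
have : \sum_(j < k.+2) cotc R j * sinc_c R (k.+1 - j) = cos_c R k.+1.
  by rewrite big_ord_recr /= subnn s0 mulr1 cE addrC subrK.
rewrite big_ord_recl /= subn0 mul1r cosE -natr1 mulrDl mul1r addrC => /addIr <-.
rewrite [LHS](reindex_inj rev_ord_inj); apply: eq_bigr => -[j jk] _ /=.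
by rewrite /bump /= add1n subKn// !subSS.
Qed.

(** Strong induction: both sides obey the same recursion, by [tan_node_newton] and [cotc_rec], with
    convergent coefficients and leading coefficient 1. *)
Lemma cvg_tan_node_sum k :
  \sum_(n < M) tan_node M n ^- (k.+1).*2 @[M --> \oo] --> - cotc R k.+1 / 2.
Proof.
have s0 : sinc_c R 0 = 1 by exact: divr1.
have t0 M : tan_coef M 0 = 1.
  by rewrite /tan_coef bin1 !expr1 divff ?mulr1.
elim/ltn_ind: k => k IH.
have -> : (fun M => \sum_(n < M) tan_node M n ^- k.+1.*2) = (fun M =>
   - (k.+1%:R * tan_coef M k.+1) -
   \sum_(j < k) (\sum_(n < M) tan_node M n ^- (k - j).*2) * tan_coef M j.+1).
  apply/funext => M; rewrite -tan_node_newton big_ord_recl /= subn0 t0 mulr1.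
  under [X in _ = _ + X - _]eq_bigr do rewrite /bump /= add1n subSS.
  by rewrite addrK.
have -> : - cotc R k.+1 / 2 = - (k.+1%:R * sinc_c R k.+1) -
   \sum_(j < k) (- cotc R (k - j) / 2) * sinc_c R j.+1.
  have := cotc_rec k; rewrite big_ord_recl /= subn0 s0 mulr1 => /(canRL (addrK _)) ->.
  rewrite -muln2 natrM opprB mulrBl mulr_suml.
  rewrite (eq_bigr (fun j : 'I_k => - (- cotc R (k - j) / 2 * sinc_c R j.+1))).
    by rewrite sumrN; field.
  by move=> j _; rewrite /bump /= add1n subSS; field.
apply: cvgB; first by apply: cvgN; apply: cvgMl_tmp; exact: cvg_tan_coef.
apply: cvg_sumr => -[j jk]; apply: cvgM; last exact: cvg_tan_coef.
have -> : (k - j = (k - j).-1.+1)%N by rewrite prednK// subn_gt0.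
by apply: IH; rewrite /= prednK ?subn_gt0// leq_subr.
Qed.

(** All terms being positive, the first $M$ are at most the full sum over $M' \ge M$ tangent nodes;
    then $M' \to \infty$ with $M$ fixed. *)
Lemma node_sum_le M k : \sum_(n < M) 2 * node n ^- (k.+1).*2 <= - cotc R k.+1.
Proof.
rewrite -mulr_sumr mulrC -ler_pdivlMr//.
have lhs : \sum_(n < M) tan_node M' n ^- (k.+1).*2 @[M' --> \oo] -->
    \sum_(n < M) node n ^- (k.+1).*2.
  apply: cvg_sumr => n; apply: cvgV; first by rewrite expf_neq0// lt0r_neq0// node_gt0.
  by apply: cvg_exprn; exact: cvg_tan_node.
apply: (ler_cvg_to lhs (@cvg_tan_node_sum k)).
near=> M'; have MM' : (M <= M')%N by near: M'; exact: nbhs_infty_ge.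
rewrite -!(big_mkord xpredT (fun n => tan_node M' n ^- k.+1.*2)).
rewrite [leRHS](@big_cat_nat _ _ _ M)//= lerDl big_nat sumr_ge0// => n /andP[_ nM].
by rewrite invr_ge0 exprn_ge0// ltW// tan_node_gt0.
Unshelve. all: by end_near. Qed.

Lemma tan_node_sum_le M k :
  \sum_(n < M) tan_node M n ^- (k.+1).*2 <= \sum_(n < M) node n ^- (k.+1).*2.
Proof.
apply: ler_sum => n _; rewrite lef_pV2 ?posrE ?exprn_gt0 ?node_gt0 ?tan_node_gt0//.
apply: lerXn2r; rewrite ?nnegrE; last exact: node_le_tan_node.
  by rewrite ltW ?node_gt0.
by rewrite ltW ?tan_node_gt0.
Qed.

(** A squeeze between [node_sum_le] and the tangent node sums, which are smaller because $c \le N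
    \tan(c/N)$. This is Euler's formula for the even zeta values. *)
Lemma cvg_node_sum k :
  \sum_(n < M) 2 * node n ^- (k.+1).*2 @[M --> \oo] --> - cotc R k.+1.
Proof.
have tl := cvgMl_tmp (a := 2 : R) (@cvg_tan_node_sum k).
rewrite mulrC divfK// in tl.
apply: (@squeeze_cvgr _ _ _ _ (fun M => 2 * \sum_(n < M) tan_node M n ^- k.+1.*2)
  (fun=> - cotc R k.+1)); [|exact: tl|exact: cvg_cst].
near=> M; rewrite -mulr_sumr ler_pM2l// tan_node_sum_le mulr_sumr.
exact: node_sum_le.
Unshelve. all: by end_near. Qed.

Lemma sum_inv_sqr_le M : \sum_(n < M.+1) n.+1%:R ^- 2 <= 2 - M.+1%:R^-1 :> R.
Proof.
elim: M => [|M IH]; first by rewrite big_ord1 expr1n invr1; lra.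
rewrite big_ord_recr /=; apply: (le_trans (lerD IH (lexx _))).
rewrite -subr_ge0.
have -> : 2 - M.+2%:R^-1 - (2 - M.+1%:R^-1 + M.+2%:R ^- 2) = (M.+1%:R * M.+2%:R ^+ 2)^-1 :> R.
  rewrite -[M.+2%:R]natr1; set a := M.+1%:R : R.
  have a0 : 0 < a by rewrite ltr0n.
  by field; rewrite !lt0r_neq0// addr_gt0.
by rewrite invr_ge0 mulr_ge0// exprn_ge0.
Qed.

Lemma cotc_le0 k : cotc R k.+1 <= 0.
Proof.
by rewrite -oppr_ge0; apply: le_trans (node_sum_le 0 k); rewrite big_ord0.
Qed.

(** Factoring $\pi^{-2k}$ out of the node sums leaves at most $2\sum_n n^{-2} \le 4$. Hence the
    series of $z\cot z$ is dominated geometrically for $|z| < \pi$. *)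
Lemma normr_cotc_le k : `|cotc R k| <= 4 * pi ^- k.*2.
Proof.
case: k => [|k]; first by rewrite /cotc/= normr1 invr1; lra.
rewrite ler0_norm ?cotc_le0//.
apply: (cvgr_to_le (@cvg_node_sum k)); near=> M; rewrite -mulr_sumr.
have pi0 : 0 < pi ^- k.+1.*2 :> R by rewrite invr_gt0 exprn_gt0// pi_gt0.
have : \sum_(n < M) node n ^- k.+1.*2 <= \sum_(n < M) n.+1%:R ^- 2 * pi ^- k.+1.*2.
  apply: ler_sum => n _; rewrite /node exprMn invfM ler_pM2r//.
  rewrite lef_pV2 ?posrE ?exprn_gt0//.
  have -> : k.+1.*2 = (k.*2 + 2)%N by rewrite addn2.
  rewrite exprD ler_peMl// ?exprn_ge0//.
  by rewrite exprn_ege1// ler1n.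
rewrite -mulr_suml => h; have : \sum_(n < M) n.+1%:R ^- 2 <= 2 :> R.
  case: (M) => [|M']; first by rewrite big_ord0.
  by apply: (le_trans (sum_inv_sqr_le M')); rewrite gerBl.
rewrite -(ler_pM2r pi0) => h2; lra.
Unshelve. all: by end_near. Qed.

End CotangentExpansion.

(** * Euclidean norm and bounded matrices *)

Section EuclideanNorm.
Variables (R : realType) (n : nat).
Implicit Types (u v w : 'cV[R]_n) (a : R).

Definition dot u v : R := (u^T *m v) 0 0.

Lemma dotC u v : dot u v = dot v u.
Proof. by rewrite /dot -[v]trmxK -trmx_mul !trmxK mxE. Qed.

Lemma dotDr u v w : dot u (v + w) = dot u v + dot u w.
Proof. by rewrite /dot mulmxDr mxE. Qed.

Lemma dotZr u a v : dot u (a *: v) = a * dot u v.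
Proof. by rewrite /dot -scalemxAr mxE. Qed.

Lemma dotDl u v w : dot (v + w) u = dot v u + dot w u.
Proof. by rewrite dotC dotDr !(dotC u). Qed.

Lemma dotZl u a v : dot (a *: v) u = a * dot v u.
Proof. by rewrite dotC dotZr dotC. Qed.

Lemma dotNr u v : dot u (- v) = - dot u v.
Proof. by rewrite -scaleN1r dotZr mulN1r. Qed.

Lemma dotNl u v : dot (- v) u = - dot v u.
Proof. by rewrite dotC dotNr dotC. Qed.

Lemma dot0r u : dot u 0 = 0.
Proof. by rewrite /dot mulmx0 mxE. Qed.

Lemma dot_sumr (I : Type) (r : seq I) u (f : I -> 'cV[R]_n) :
  dot u (\sum_(i <- r) f i) = \sum_(i <- r) dot u (f i).
Proof. by rewrite /dot mulmx_sumr summxE. Qed.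

Lemma dot_mulmxl (A : 'M[R]_n) u v : dot (A *m u) v = dot u (A^T *m v).
Proof. by rewrite /dot trmx_mul mulmxA. Qed.

Lemma sqr_vnorm u : vnorm u ^+ 2 = dot u u.
Proof.
rewrite /vnorm sqr_sqrtr ?sumr_ge0// => [|i _]; last exact: sqr_ge0.
by rewrite /dot mxE; apply: eq_bigr => i _; rewrite mxE expr2.
Qed.

Lemma vnorm_ge0 u : 0 <= vnorm u.
Proof. exact: sqrtr_ge0. Qed.

Lemma dot_ge0 u : 0 <= dot u u.
Proof. by rewrite -sqr_vnorm sqr_ge0. Qed.

Lemma vnorm0 : vnorm (0 : 'cV[R]_n) = 0.
Proof. by apply/eqP; rewrite -sqrf_eq0 sqr_vnorm dot0r. Qed.

Lemma normr_le_vnorm u i : `|u i 0| <= vnorm u.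
Proof.
rewrite -sqrtr_sqr ler_wsqrtr// (bigD1 i)//= lerDl sumr_ge0// => j _.
exact: sqr_ge0.
Qed.

Lemma vnorm_eq0 u : vnorm u = 0 -> u = 0.
Proof.
by move=> u0; apply/colP => i; apply/eqP; rewrite mxE -normr_le0 -u0 normr_le_vnorm.
Qed.

Lemma vnormZ a u : vnorm (a *: u) = `|a| * vnorm u.
Proof.
apply/eqP; rewrite -(@eqrXn2 _ 2)// ?mulr_ge0 ?vnorm_ge0//.
by rewrite exprMn !sqr_vnorm dotZl dotZr real_normK ?num_real// expr2 mulrA.
Qed.

(** Cauchy-Schwarz: the squared norm of $|v|u - |u|v$ is $2|u||v|(|u||v| - \langle u,v\rangle)$. *)
Lemma dot_le u v : dot u v <= vnorm u * vnorm v.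
Proof.
have [/eqP uv0|uv0] := eqVneq (vnorm u * vnorm v) 0.
  move: (uv0); rewrite mulf_eq0 => /orP[]/eqP/vnorm_eq0 ->.
    by rewrite dotC dot0r vnorm0 mul0r.
  by rewrite dot0r vnorm0 mulr0.
have uv_gt0 : 0 < vnorm u * vnorm v by rewrite lt_neqAle eq_sym uv0 mulr_ge0 ?vnorm_ge0.
rewrite -(ler_pM2l uv_gt0).
have := dot_ge0 (vnorm v *: u - vnorm u *: v).
rewrite !(dotDl, dotDr, dotNl, dotNr, dotZl, dotZr) -!sqr_vnorm (dotC v u).
nra.
Qed.

Lemma normr_dot_le u v : `|dot u v| <= vnorm u * vnorm v.
Proof.
rewrite ler_norml dot_le andbT lerNl -dotNr.
by apply: le_trans (dot_le _ _) _; rewrite -scaleN1r vnormZ normrN1 mul1r.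
Qed.

Lemma vnormD u v : vnorm (u + v) <= vnorm u + vnorm v.
Proof.
rewrite -(@ler_pXn2r _ 2)// ?nnegrE ?addr_ge0 ?vnorm_ge0//.
rewrite sqr_vnorm !(dotDl, dotDr) -!sqr_vnorm (dotC v u).
by have := dot_le u v; nra.
Qed.

Lemma vnorm_sum (I : Type) (r : seq I) (f : I -> 'cV[R]_n) :
  vnorm (\sum_(i <- r) f i) <= \sum_(i <- r) vnorm (f i).
Proof.
elim/big_rec2: _ => [|i a b _ ab]; first by rewrite vnorm0.
by apply: le_trans (vnormD _ _) _; rewrite lerD2l.
Qed.

(** Bounds on the operator norm are kept as pointwise inequalities, which pass to sums, products and
    powers without suprema. *)
Definition bounded (A : 'M[R]_n) (s : R) := forall u, vnorm (A *m u) <= s * vnorm u.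

Lemma bounded_le (A : 'M[R]_n) (s s' : R) : s <= s' -> bounded A s -> bounded A s'.
Proof. by move=> ss' As u; apply: le_trans (As u) _; rewrite ler_wpM2r ?vnorm_ge0. Qed.

Lemma boundedD (A B : 'M[R]_n) (s s' : R) :
  bounded A s -> bounded B s' -> bounded (A + B) (s + s').
Proof.
move=> As Bs u; rewrite mulmxDl; apply: le_trans (vnormD _ _) _.
by rewrite mulrDl lerD.
Qed.

Lemma boundedZ (A : 'M[R]_n) (s a : R) : bounded A s -> bounded (a *: A) (`|a| * s).
Proof. by move=> As u; rewrite -scalemxAl vnormZ -mulrA ler_wpM2l. Qed.

Lemma boundedN (A : 'M[R]_n) (s : R) : bounded A s -> bounded (- A) s.
Proof.
move=> /(@boundedZ _ _ (-1)); rewrite normrN1 mul1r scaleN1r.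
exact.
Qed.

Lemma boundedM (A B : 'M[R]_n) (s s' : R) : 0 <= s ->
  bounded A s -> bounded B s' -> bounded (A *m B) (s * s').
Proof.
move=> s0 As Bs u; rewrite -mulmxA; apply: le_trans (As _) _.
by rewrite -mulrA ler_wpM2l.
Qed.

Lemma boundedX (A : 'M[R]_n) (s : R) k : 0 <= s -> bounded A s -> bounded (A ^+ k) (s ^+ k).
Proof.
move=> s0 As; elim: k => [|k IH]; first by move=> u; rewrite !expr0 mul1mx mul1r.
by rewrite !exprS; apply: boundedM.
Qed.

Lemma bounded_sum m (U : 'I_m -> 'M[R]_n) (s : 'I_m -> R) :
  (forall i, bounded (U i) (s i)) -> bounded (\sum_i U i) (\sum_i s i).
Proof.
move=> Us; elim/big_rec2: _ => [|i a A _ Aa]; last exact: boundedD.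
by move=> u; rewrite mul0mx vnorm0 mul0r.
Qed.

Lemma bounded_exists (A : 'M[R]_n) : exists2 s, 0 <= s & bounded A s.
Proof.
exists (\sum_i vnorm (col i A)); first by rewrite sumr_ge0// => i _; exact: vnorm_ge0.
move=> u; have -> : A *m u = \sum_i u i 0 *: col i A.
  by apply/colP => k; rewrite !mxE summxE; apply: eq_bigr => i _; rewrite !mxE mulrC.
apply: le_trans (vnorm_sum _ _) _; rewrite mulr_suml; apply: ler_sum => i _.
by rewrite vnormZ mulrC ler_wpM2l ?vnorm_ge0 ?normr_le_vnorm.
Qed.

Lemma opnorm_bounded (A : 'M[R]_n) : bounded A (opnorm A).
Proof.
move=> u; have [K K0 AK] := bounded_exists A.
(* [sup] dominates the set only if the set is bounded above, which finite dimension ensures. *)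
have ub : has_ubound [set vnorm (A *m x) | x in [set x : 'cV[R]_n | vnorm x <= 1]].
  exists K => _ [v /= v1 <-]; apply: le_trans (AK v) _.
  by rewrite ler_piMr.
have [/vnorm_eq0 ->|u0] := eqVneq (vnorm u) 0.
  by rewrite mulmx0 vnorm0 mulr0.
have u_gt0 : 0 < vnorm u by rewrite lt_neqAle eq_sym u0 vnorm_ge0.
rewrite -ler_pdivrMr//; apply: ub_le_sup => //.
exists ((vnorm u)^-1 *: u) => /=.
  by rewrite vnormZ gtr0_norm ?invr_gt0// mulVf.
by rewrite -scalemxAr vnormZ gtr0_norm ?invr_gt0// mulrC.
Qed.

Lemma opnorm_ge0 (A : 'M[R]_n) : 0 <= opnorm A.
Proof.
have [K K0 AK] := bounded_exists A.
apply: ub_le_sup.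
  by exists K => _ [v /= v1 <-]; apply: le_trans (AK v) _; rewrite ler_piMr.
by exists 0 => /=; rewrite ?mulmx0 vnorm0.
Qed.

Lemma opnorm_le (A : 'M[R]_n) (s : R) : 0 <= s -> bounded A s -> opnorm A <= s.
Proof.
move=> s0 As; apply: ge_sup.
  by exists (vnorm (A *m 0)); exists 0 => //=; rewrite vnorm0.
by move=> _ [v /= v1 <-]; apply: le_trans (As v) _; rewrite ler_piMr.
Qed.

End EuclideanNorm.

(** * The matrices $A(\tau)$ and the domain $\Omega_*$ *)

Section LinearFamily.
Variables (R : realType) (q m : nat) (U : 'I_m -> 'M[R]_q).
Implicit Types (tau h : 'rV[R]_m).

Lemma AmatD tau h : Amat U (tau + h) = Amat U tau + Amat U h.
Proof. by rewrite /Amat -big_split; apply: eq_bigr => j _; rewrite mxE scalerDl. Qed.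

Lemma AmatZ (a : R) h : Amat U (a *: h) = a *: Amat U h.
Proof. by rewrite /Amat scaler_sumr; apply: eq_bigr => j _; rewrite mxE scalerA. Qed.

Lemma AmatN h : Amat U (- h) = - Amat U h.
Proof. by rewrite -scaleN1r AmatZ scaleN1r. Qed.

Lemma Amat_skew tau : (forall j, (U j)^T = - U j) -> (Amat U tau)^T = - Amat U tau.
Proof.
move=> Usk; rewrite /Amat raddf_sum -sumrN; apply: eq_bigr => j _.
by rewrite /= linearZ /= Usk scalerN.
Qed.

Lemma normr_coord_le h j : `|h 0 j| <= `|h|.
Proof. by rewrite [leRHS]mx_normrE (le_bigmax _ (fun ij => `|h ij.1 ij.2|) (0, j)). Qed.

Lemma Amat_bounded : exists K, [/\ 0 < K, forall j, bounded (U j) K &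
  forall h, bounded (Amat U h) (K * `|h|)].
Proof.
have /choice[s sP] : forall j, exists s, 0 <= s /\ bounded (U j) s.
  move=> j; have [K K0 KU] := bounded_exists (U j); by exists K.
have s0 j : 0 <= s j by case: (sP j).
(* The summand 1 makes the constant positive, so that it can serve as a divisor in radii $d/K$. *)
exists (1 + \sum_j s j); split; first by rewrite ltr_pwDl// sumr_ge0.
  move=> j; apply: (@bounded_le _ _ _ (s j)); last by case: (sP j).
  by rewrite (bigD1 j)//= addrCA lerDl addr_ge0// sumr_ge0.
move=> h; apply: (@bounded_le _ _ _ (\sum_j `|h 0 j| * s j)).
  rewrite mulrDl mulr_suml ler_wpDl ?mul1r//; apply: ler_sum => j _.
  by rewrite mulrC ler_wpM2l ?normr_coord_le//; case: (sP j).
by apply: bounded_sum => j; apply: boundedZ; case: (sP j).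
Qed.

(** A bound $s < \pi$ leaves explicit room $\pi - s$ for perturbations. *)
Lemma OmegaP tau : Omega U tau <->
  exists s, [/\ 0 <= s, s < pi & bounded (Amat U tau) s].
Proof.
split => [Ot|[s [s0 spi As]]].
  by exists (opnorm (Amat U tau)); split; [exact: opnorm_ge0 | | exact: opnorm_bounded].
by rewrite /Omega /=; apply: le_lt_trans (opnorm_le s0 As) spi.
Qed.

End LinearFamily.

(** * Second order Taylor expansion of [phi] *)

Section PowerExpansion.
Variables (R : realType) (q : nat) (x : 'cV[R]_q).
Implicit Types (A H : 'M[R]_q).

(* First and second order parts of [(A + H) ^+ k *m x] as a function of [H],
   the latter polarized. *)
Fixpoint pow_d1 A H k : 'cV[R]_q :=
  if k is k'.+1 then A *m pow_d1 A H k' + H *m (A ^+ k' *m x) else 0.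

Fixpoint pow_d2 A H H' k : 'cV[R]_q :=
  if k is k'.+1 then A *m pow_d2 A H H' k' + H *m pow_d1 A H' k' else 0.

Definition pow_rem A H k : 'cV[R]_q :=
  (A + H) ^+ k *m x - A ^+ k *m x - pow_d1 A H k - pow_d2 A H H k.

Lemma pow_d1_sum m A (U : 'I_m -> 'M[R]_q) (h : 'I_m -> R) k :
  pow_d1 A (\sum_j h j *: U j) k = \sum_j h j *: pow_d1 A (U j) k.
Proof.
elim: k => [|k /= ->]; first by rewrite [RHS]big1// => j _; rewrite scaler0.
rewrite mulmx_sumr mulmx_suml -big_split; apply: eq_bigr => j _ /=.
by rewrite scalerDr -scalemxAr -scalemxAl.
Qed.

Lemma pow_d2_sum m A (U : 'I_m -> 'M[R]_q) (h : 'I_m -> R) k :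
  let H := \sum_j h j *: U j in
  pow_d2 A H H k = \sum_i \sum_j (h i * h j) *: pow_d2 A (U i) (U j) k.
Proof.
move=> H; elim: k => [|k /= ->].
  by rewrite [RHS]big1// => i _; rewrite big1// => j _; rewrite scaler0.
rewrite mulmx_sumr mulmx_suml -big_split; apply: eq_bigr => i _ /=.
rewrite mulmx_sumr pow_d1_sum mulmx_sumr -big_split; apply: eq_bigr => j _ /=.
by rewrite scalerDr -!scalemxAr -scalemxAl scalerA mulrC.
Qed.

Section Bounds.
Variables (A : 'M[R]_q) (rho d : R).
Hypotheses (rho0 : 0 <= rho) (d0 : 0 < d) (Arho : bounded A rho).

Lemma pow_d0_bound k : vnorm (A ^+ k *m x) <= (rho + d) ^+ k * vnorm x.
Proof.
apply: le_trans (boundedX k rho0 Arho x) _.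
by rewrite ler_wpM2r ?vnorm_ge0// lerXn2r ?nnegrE ?addr_ge0 ?lerDl// ltW.
Qed.

(** The factor $k$ from differentiating a $k$-th power is absorbed by enlarging [rho] to [rho + d],
    at the price of $1/d$: the induction step is $\rho\,(e/d) + e = (e/d)(\rho + d)$. *)
Lemma pow_d1_bound H e k : 0 <= e -> bounded H e ->
  vnorm (pow_d1 A H k) <= e / d * ((rho + d) ^+ k * vnorm x).
Proof.
move=> e0 He; have X0 i : 0 <= (rho + d) ^+ i * vnorm x.
  by rewrite mulr_ge0 ?vnorm_ge0// exprn_ge0// addr_ge0// ltW.
have ed0 : 0 <= e / d by rewrite divr_ge0// ltW.
elim: k => [|k IH] /=; first by rewrite vnorm0 mulr_ge0.
apply: le_trans (vnormD _ _) _.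
have h1 := le_trans (Arho _) (ler_wpM2l rho0 IH).
have h2 := le_trans (He _) (ler_wpM2l e0 (pow_d0_bound k)).
apply: le_trans (lerD h1 h2) _; rewrite le_eqVlt; apply/orP; left; apply/eqP.
by rewrite exprS; field; rewrite lt0r_neq0.
Qed.

Lemma pow_d2_bound H H' e e' k : 0 <= e -> 0 <= e' -> bounded H e -> bounded H' e' ->
  vnorm (pow_d2 A H H' k) <= (e / d) * (e' / d) * ((rho + d) ^+ k * vnorm x).
Proof.
move=> e0 e'0 He He'; have X0 i : 0 <= (rho + d) ^+ i * vnorm x.
  by rewrite mulr_ge0 ?vnorm_ge0// exprn_ge0// addr_ge0// ltW.
have ed0 : 0 <= e / d by rewrite divr_ge0// ltW.
have ed0' : 0 <= e' / d by rewrite divr_ge0// ltW.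
elim: k => [|k IH] /=; first by rewrite vnorm0 mulr_ge0// mulr_ge0.
apply: le_trans (vnormD _ _) _.
have h1 := le_trans (Arho _) (ler_wpM2l rho0 IH).
have h2 := le_trans (He _) (ler_wpM2l e0 (pow_d1_bound k e'0 He')).
apply: le_trans (lerD h1 h2) _; rewrite le_eqVlt; apply/orP; left; apply/eqP.
by rewrite exprS; field; rewrite lt0r_neq0.
Qed.

(** Same scheme as [pow_d1_bound], but the recursion multiplies by [A + H], of norm at most
    [rho + d]; this costs one more [d]. *)
Lemma pow_rem_bound H e k : 0 <= e <= d -> bounded H e ->
  vnorm (pow_rem A H k) <= (e / d) ^+ 3 * ((rho + d *+ 2) ^+ k * vnorm x).
Proof.
move=> /andP[e0 ed] He.
have ed0 : 0 <= e / d by rewrite divr_ge0// ltW.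
have dd0 : 0 <= d by exact: ltW.
elim: k => [|k IH].
  rewrite /pow_rem !expr0 !mul1mx subrr !subr0 vnorm0.
  by rewrite mulr_ge0 ?exprn_ge0// mulr_ge0 ?vnorm_ge0.
have -> : pow_rem A H k.+1 = (A + H) *m pow_rem A H k + H *m pow_d2 A H H k.
  rewrite /pow_rem !exprS /= -!mulmxE -!mulmxA !mulmxBr.
  move: ((A + H) *m (_ *m x)) (A ^+ k *m x) (pow_d1 _ _ _) (pow_d2 _ _ _ _) => Q a b c.
  rewrite !mulmxDl; move: (A *m a) (H *m a) (A *m b) (H *m b) (A *m c) (H *m c).
  by move=> *; apply/colP => i; rewrite !mxE; ring.
apply: le_trans (vnormD _ _) _.
have h1 := le_trans (boundedD Arho He _) (ler_wpM2l (addr_ge0 rho0 e0) IH).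
have h2 := le_trans (He _) (ler_wpM2l e0 (pow_d2_bound k e0 e0 He He)).
have X0 : 0 <= (rho + d) ^+ k * vnorm x.
  by rewrite mulr_ge0 ?vnorm_ge0// exprn_ge0// addr_ge0.
have X1 : (rho + d) ^+ k * vnorm x <= (rho + d *+ 2) ^+ k * vnorm x.
  rewrite ler_wpM2r ?vnorm_ge0// lerXn2r ?nnegrE ?addr_ge0 ?mulrn_wge0//.
  by rewrite lerD2l mulr2n lerDl.
apply: le_trans (lerD h1 h2) _; rewrite (exprS (rho + d *+ 2)).
move: X0 X1 ed0; set X := _ ^+ k * _; set Y := _ ^+ k * _ => X0 X1 ed0.
have -> : (rho + d *+ 2) * (rho + d *+ 2) ^+ k * vnorm x = (rho + d *+ 2) * Y by rewrite mulrA.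
have -> : e = e / d * d by rewrite divfK// lt0r_neq0.
rewrite -!(mulrA _ d) mulfV ?lt0r_neq0// !mulr1.
have t1 : e / d <= 1 by rewrite ler_pdivrMr// mul1r.
set t := e / d in ed0 t1 *.
have t3 : 0 <= t ^+ 3 by rewrite exprn_ge0.
have : t ^+ 3 * d * X <= t ^+ 3 * d * Y by rewrite ler_wpM2l// mulr_ge0.
have : t ^+ 3 * Y * (t * d) <= t ^+ 3 * Y * d.
  by rewrite ler_wpM2l ?ler_piMl// mulr_ge0// (le_trans X0).
rewrite mulr2n; nra.
Qed.

End Bounds.

(** With $a, b, c, r$ of orders 0 to 3, what is left over is $2ar + 2bc + 2br + cc + 2cr + rr$, of
    order at least 3; the weights add up to 10. *)
Lemma sqr_pow_taylor (a b c r : 'cV[R]_q) (e X : R) : 0 <= e <= 1 -> 0 <= X ->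
  vnorm a <= X -> vnorm b <= e * X -> vnorm c <= e * e * X -> vnorm r <= e ^+ 3 * X ->
  `|dot (a + b + c + r) (a + b + c + r) - dot a a - 2 * dot a b -
     (dot b b + 2 * dot a c)| <= 10 * (e ^+ 3 * X ^+ 2).
Proof.
move=> /andP[e0 e1] X0 aX bX cX rX.
have cs (u v : 'cV[R]_q) i j : vnorm u <= e ^+ i * X -> vnorm v <= e ^+ j * X -> (3 <= i + j)%N ->
    `|dot u v| <= e ^+ 3 * X ^+ 2.
  move=> uX vX ij; apply: le_trans (normr_dot_le u v) _.
  apply: le_trans (ler_pM (vnorm_ge0 _) (vnorm_ge0 _) uX vX) _.
  rewrite mulrACA -exprD -expr2 ler_wpM2r ?sqr_ge0//.
  by rewrite ler_wiXn2l.
have a' : vnorm a <= e ^+ 0 * X by rewrite mul1r.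
have b' : vnorm b <= e ^+ 1 * X by [].
have c' : vnorm c <= e ^+ 2 * X by [].
have := cs _ _ _ _ a' rX isT; have := cs _ _ _ _ b' c' isT.
have := cs _ _ _ _ b' rX isT; have := cs _ _ _ _ c' c' isT.
have := cs _ _ _ _ c' rX isT; have := cs _ _ _ _ rX rX isT.
rewrite !(dotDl, dotDr) (dotC b a) (dotC c a) (dotC r a) (dotC c b) (dotC r b) (dotC r c).
rewrite !ler_norml => /andP[? ?] /andP[? ?] /andP[? ?] /andP[? ?] /andP[? ?] /andP[? ?].
by apply/andP; split; lra.
Qed.

End PowerExpansion.

(** * Series dominated by a geometric series *)

Section GeometricDomination.
Variable R : realType.
Implicit Types (u : nat -> R) (C z : R).

Lemma geometric_sum_le C z N : 0 <= C -> 0 <= z < 1 ->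
  \sum_(k < N) C * z ^+ k <= C / (1 - z).
Proof.
move=> C0 /andP[z0 z1]; have z1' : 0 < 1 - z by rewrite subr_gt0.
have -> : \sum_(k < N) C * z ^+ k = C / (1 - z) * (1 - z ^+ N).
  elim: N => [|N IH]; first by rewrite big_ord0 expr0 subrr mulr0.
  by rewrite big_ord_recr IH /= exprS; field; rewrite lt0r_neq0.
by apply: ler_piMr; [rewrite divr_ge0// ltW | rewrite gerBl exprn_ge0].
Qed.

Lemma geometric_dominated_cvg u C z : 0 <= z < 1 ->
  (forall k, `|u k| <= C * z ^+ k) -> cvgn (fun N => \sum_(k < N) u k).
Proof.
move=> /andP[z0 z1] uC.
have : cvgn (series u).
  apply: normed_cvg; apply: (@series_le_cvg _ _ (geometric C z)) => [n|n|n|] //=.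
  - by apply: le_trans (uC n).
  - by apply: is_cvg_geometric_series; rewrite ger0_norm.
by congr (cvgn _); apply/funext => N; rewrite /series/= big_mkord.
Qed.

End GeometricDomination.

(** * Second order expansions with controlled coefficients *)

Section SecondOrderExpansion.
Variables (R : realType) (m : nat).
Implicit Types (f : 'rV[R]_m -> R) (tau h : 'rV[R]_m).

Definition lin (l : 'I_m -> R) h : R := \sum_j h 0 j * l j.
Definition quad (b : 'I_m -> 'I_m -> R) h : R := \sum_i \sum_j h 0 i * h 0 j * b i j.

(** One constant bounds the coefficients and the cubic error, so that expansions can be summed and
    compared at neighbouring points. As [b] is neither halved nor symmetrized, the Hessian will be
    $b + b^T$. *)
Definition taylor2 f tau (r K : R) := exists l b,
  [/\ forall j, `|l j| <= K, forall i j, `|b i j| <= K &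
   forall h, `|h| <= r -> `|f (tau + h) - f tau - lin l h - quad b h| <= K * `|h| ^+ 3].

Lemma taylor2_le f tau (r K K' : R) : K <= K' -> taylor2 f tau r K -> taylor2 f tau r K'.
Proof.
move=> KK' [l [b [lK bK fK]]]; exists l, b; split=> [j|i j|h hr].
- exact: le_trans (lK j) _.
- exact: le_trans (bK i j) _.
- by apply: le_trans (fK h hr) _; rewrite ler_wpM2r// exprn_ge0.
Qed.

Lemma taylor2Z f tau (r K c : R) : taylor2 f tau r K ->
  taylor2 (fun t => c * f t) tau r (`|c| * K).
Proof.
move=> [l [b [lK bK fK]]]; exists (fun j => c * l j), (fun i j => c * b i j).
split=> [j|i j|h hr]; rewrite ?normrM ?ler_wpM2l//.
have -> : c * f (tau + h) - c * f tau - lin (fun j => c * l j) h -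
    quad (fun i j => c * b i j) h = c * (f (tau + h) - f tau - lin l h - quad b h).
  rewrite !mulrBr; congr (_ - _ - _).
    by rewrite /lin mulr_sumr; apply: eq_bigr => j _; rewrite mulrCA.
  rewrite /quad mulr_sumr; apply: eq_bigr => i _; rewrite mulr_sumr.
  by apply: eq_bigr => j _; rewrite mulrCA.
by rewrite normrM -mulrA ler_wpM2l ?fK.
Qed.

Lemma taylor2_add_lin f tau (r K : R) (c : 'I_m -> R) : taylor2 f tau r K ->
  taylor2 (fun t => f t + lin c t) tau r (K + \sum_j `|c j|).
Proof.
move=> [l [b [lK bK fK]]]; exists (fun j => l j + c j), b.
have S0 : 0 <= \sum_j `|c j| by rewrite sumr_ge0.
split=> [j|i j|h hr].
- apply: le_trans (ler_normD _ _) _; rewrite lerD//.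
  by rewrite (bigD1 j)//= lerDl sumr_ge0.
- by rewrite (le_trans (bK i j))// lerDl.
have -> : f (tau + h) + lin c (tau + h) - (f tau + lin c tau) -
    lin (fun j => l j + c j) h - quad b h = f (tau + h) - f tau - lin l h - quad b h.
  have -> : lin c (tau + h) = lin c tau + lin c h.
    by rewrite /lin -big_split; apply: eq_bigr => j _; rewrite mxE mulrDl.
  have -> : lin (fun j => l j + c j) h = lin l h + lin c h.
    by rewrite /lin -big_split; apply: eq_bigr => j _; rewrite mulrDr.
  by ring.
by rewrite (le_trans (fK h hr))// ler_wpM2r ?exprn_ge0// lerDl.
Qed.

(** The coefficients of the $k$-th expansion are at most $Cz^k$, so their series converge; the error
    bounds add up to $C/(1-z)$ and survive the limit. *)
Lemma taylor2_series (f : nat -> 'rV[R]_m -> R) F tau (r C z : R) :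
  0 <= r -> 0 <= C -> 0 <= z < 1 ->
  (forall k, taylor2 (f k) tau r (C * z ^+ k)) ->
  (forall h, `|h| <= r -> \sum_(k < N) f k (tau + h) @[N --> \oo] --> F (tau + h)) ->
  taylor2 F tau r (C / (1 - z)).
Proof.
move=> r0 C0 z01 /choice[l /choice[b lb]] fF.
have lK k j : `|l k j| <= C * z ^+ k by case: (lb k).
have bK k i j : `|b k i j| <= C * z ^+ k by case: (lb k).
have cl j := geometric_dominated_cvg z01 (lK ^~ j).
have cb i j := geometric_dominated_cvg z01 (fun k => bK k i j).
exists (fun j => limn (fun N => \sum_(k < N) l k j)).
exists (fun i j => limn (fun N => \sum_(k < N) b k i j)).
have sum_le N (u : nat -> R) : (forall k, `|u k| <= C * z ^+ k) ->
    `|\sum_(k < N) u k| <= C / (1 - z).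
  move=> uC; apply: le_trans (ler_norm_sum _ _ _) _.
  by apply: le_trans (geometric_sum_le N C0 z01); apply: ler_sum => k _.
split=> [j|i j|h hr].
- by apply: (cvgr_to_le (cvg_norm (cl j))); apply: nearW => N; exact: (sum_le N (l ^~ j)).
- apply: (cvgr_to_le (cvg_norm (cb i j))); apply: nearW => N.
  exact: (sum_le N (fun k => b k i j)).
have fF0 : \sum_(k < N) f k tau @[N --> \oo] --> F tau.
  by have := fF 0; rewrite addr0; apply; rewrite normr0.
set L := lin _ _; set B := quad _ _.
have cL : lin (fun j => \sum_(k < N) l k j) h @[N --> \oo] --> L.
  rewrite /L /lin; apply: cvg_sumr => j; by apply: cvgMl_tmp; exact: cl.
have cB : quad (fun i j => \sum_(k < N) b k i j) h @[N --> \oo] --> B.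
  rewrite /B /quad; apply: cvg_sumr => i; apply: cvg_sumr => j.
  by apply: cvgMl_tmp; exact: cb.
apply: (cvgr_to_le (cvg_norm (cvgB (cvgB (cvgB (fF h hr) fF0) cL) cB))).
apply: nearW => N; rewrite -[X in `|X|]/(\sum_(k < N) f k (tau + h) - \sum_(k < N) f k tau -
  lin (fun j => \sum_(k < N) l k j) h - quad (fun i j => \sum_(k < N) b k i j) h).
have -> : \sum_(k < N) f k (tau + h) - \sum_(k < N) f k tau -
  lin (fun j => \sum_(k < N) l k j) h - quad (fun i j => \sum_(k < N) b k i j) h =
  \sum_(k < N) (f k (tau + h) - f k tau - lin (l k) h - quad (b k) h).
  rewrite !sumrB; congr (_ - _ - _).
    rewrite /lin [RHS]exchange_big; apply: eq_bigr => j _; by rewrite mulr_sumr.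
  rewrite /quad [RHS]exchange_big; apply: eq_bigr => i _; rewrite [RHS]exchange_big.
  by apply: eq_bigr => j _; rewrite mulr_sumr.
apply: le_trans (ler_norm_sum _ _ _) _.
apply: (@le_trans _ _ (\sum_(k < N) C * z ^+ k * `|h| ^+ 3)).
  by apply: ler_sum => k _; case: (lb k) => _ _; apply.
by rewrite -mulr_suml ler_wpM2r ?exprn_ge0// geometric_sum_le.
Qed.

End SecondOrderExpansion.

(** * The power series of [phi] and the expansion of its terms *)

Section PhiSeries.
Variables (R : realType) (q m : nat) (U : 'I_m -> 'M[R]_q) (x : 'cV[R]_q).
Implicit Types (tau h : 'rV[R]_m) (A : 'M[R]_q).

Definition sqpow A k : R := dot (A ^+ k *m x) (A ^+ k *m x).

(** By skew symmetry $(-A^2)^k = (A^k)^T A^k$. The resulting terms are nonnegative, which later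
    permits an exchange of sums. *)
Lemma dot_opp_sqr_pow A k : A^T = - A -> dot x ((- (A *m A)) ^+ k *m x) = sqpow A k.
Proof.
move=> Ask; have trX : (A ^+ k)^T = (- A) ^+ k.
  elim: k => [|k IH]; first by rewrite !expr0 trmx1.
  by rewrite exprS exprSr -!mulmxE trmx_mul IH Ask.
rewrite /sqpow dot_mulmxl trX mulmxA; congr (dot _ (_ *m _)).
rewrite mulmxE -exprMn_comm; last by rewrite /GRing.comm mulNr mulrN.
by rewrite mulNr.
Qed.

Lemma coord_bounded A s i j : 0 <= s -> bounded A s -> `|A i j| <= s.
Proof.
move=> s0 As; have := As (delta_mx j 0).
have -> : vnorm (delta_mx j 0 : 'cV[R]_q) = 1.
  rewrite /vnorm (bigD1 j)//= big1 => [|l lj].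
    by rewrite mxE !eqxx expr1n addr0 sqrtr1.
  by rewrite mxE (negbTE lj) expr0n.
rewrite mulr1; apply: le_trans; rewrite -colE.
by have := normr_le_vnorm (col j A) i; rewrite mxE.
Qed.

Lemma pi_ratio (s : R) : 0 <= s < pi -> 0 <= s ^+ 2 / pi ^+ 2 < 1.
Proof.
move=> /andP[s0 spi]; rewrite divr_ge0 ?sqr_ge0//= ltr_pdivrMr ?exprn_gt0 ?pi_gt0//.
by rewrite mul1r ltrXn2r.
Qed.

Lemma cotc_pow_le (a s C : R) k : `|a| <= C * (s ^+ 2) ^+ k ->
  `|cotc R k * a| <= 4 * C * (s ^+ 2 / pi ^+ 2) ^+ k.
Proof.
move=> aC; rewrite normrM; apply: le_trans (ler_pM _ _ (normr_cotc_le R k) aC) _ => //.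
by rewrite -mul2n exprM expr_div_n; rewrite le_eqVlt; apply/orP; left; apply/eqP; ring.
Qed.

Lemma cvg_phi_series (t tau : 'rV[R]_m) : (forall j, (U j)^T = - U j) -> Omega U tau ->
  \sum_(k < N) cotc R k * sqpow (Amat U tau) k @[N --> \oo] -->
  phi U x t tau - 4 * \sum_j t 0 j * tau 0 j.
Proof.
move=> Usk /OmegaP[s [s0 spi As]]; set A := Amat U tau in As *.
(* Convergence must be proved entry by entry: [limn] of a divergent sequence carries no
   information. *)
have cE i j : cvgn (fun N => \sum_(k < N) cotc R k * ((- (A *m A)) ^+ k) i j).
  apply: (@geometric_dominated_cvg _ (fun k => cotc R k * ((- (A *m A)) ^+ k) i j)
    (4 * 1) (s ^+ 2 / pi ^+ 2)).
    by apply: pi_ratio; rewrite s0.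
  move=> k; apply: cotc_pow_le; rewrite mul1r expr2.
  apply: coord_bounded; first by rewrite exprn_ge0// mulr_ge0.
  by apply: boundedX; rewrite ?mulr_ge0//; apply: boundedN; apply: boundedM.
have -> : phi U x t tau - 4 * \sum_j t 0 j * tau 0 j =
    \sum_j (\sum_i x i 0 * UcotU U tau i j) * x j 0.
  rewrite /phi addrK mxE; apply: eq_bigr => j _; rewrite mxE; congr (_ * _).
  by apply: eq_bigr => i _; rewrite mxE.
have -> : (fun N => \sum_(k < N) cotc R k * sqpow A k) = (fun N =>
   \sum_j (\sum_i x i 0 * \sum_(k < N) cotc R k * ((- (A *m A)) ^+ k) i j) * x j 0).
  apply/funext => N.
  under [RHS]eq_bigr => j _ do
    (under eq_bigr => i _ do rewrite mulr_sumr; rewrite exchange_big mulr_suml).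
  rewrite exchange_big; apply: eq_bigr => k _ /=.
  rewrite -dot_opp_sqr_pow; last exact: Amat_skew.
  rewrite /dot mulmxA mxE mulr_sumr; apply: eq_bigr => j _.
  rewrite mxE !mulr_suml mulr_sumr; apply: eq_bigr => i _; rewrite mxE; ring.
apply: cvg_sumr => j; apply: cvgMr_tmp; apply: cvg_sumr => i; apply: cvgMl_tmp.
by rewrite /UcotU mxE; exact: cE.
Qed.

(** For $|h| \le d/K$ the matrix $A(h)$ has norm at most $d$, so the bounds on powers apply with $e
    = K|h|$. With $c = K/d$, the constant $10(1+c)^3$ dominates $2c$, $3c^2$ and $10c^3$, which come
    from the linear, quadratic and cubic parts. *)
Lemma taylor2_sqpow tau (K rho d : R) k : 0 < K -> 0 <= rho -> 0 < d ->
  (forall j, bounded (U j) K) -> (forall h, bounded (Amat U h) (K * `|h|)) ->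
  bounded (Amat U tau) rho ->
  taylor2 (fun t => sqpow (Amat U t) k) tau (d / K)
    (10 * (1 + K / d) ^+ 3 * vnorm x ^+ 2 * ((rho + d *+ 2) ^+ 2) ^+ k).
Proof.
move=> K0 rho0 d0 UK AK Arho; set A := Amat U tau in Arho *.
pose a := A ^+ k *m x.
exists (fun j => 2 * dot a (pow_d1 x A (U j) k)).
exists (fun i j => dot (pow_d1 x A (U i) k) (pow_d1 x A (U j) k) +
  2 * dot a (pow_d2 x A (U i) (U j) k)).
pose X := (rho + d *+ 2) ^+ k * vnorm x; pose Y := (rho + d) ^+ k * vnorm x.
have Y0 : 0 <= Y by rewrite mulr_ge0 ?vnorm_ge0// exprn_ge0// addr_ge0// ltW.
have YX : Y <= X.
  have dd0 := ltW d0.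
  rewrite ler_wpM2r ?vnorm_ge0// lerXn2r ?nnegrE ?addr_ge0 ?mulrn_wge0//.
  by rewrite lerD2l mulr2n lerDl.
have X0 := le_trans Y0 YX.
have -> : 10 * (1 + K / d) ^+ 3 * vnorm x ^+ 2 * ((rho + d *+ 2) ^+ 2) ^+ k =
    10 * ((1 + K / d) ^+ 3 * X ^+ 2).
  by rewrite (exprAC (rho + d *+ 2)) /X; ring.
set c := K / d; have c0 : 0 <= c by rewrite divr_ge0// ltW.
have aX : vnorm a <= X := le_trans (pow_d0_bound x rho0 d0 Arho k) YX.
have bX H e : 0 <= e -> bounded H e -> vnorm (pow_d1 x A H k) <= e / d * X.
  move=> e0 He; apply: le_trans (pow_d1_bound x rho0 d0 Arho k e0 He) _.
  by rewrite ler_wpM2l ?divr_ge0// ltW.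
have cX H H' e e' : 0 <= e -> 0 <= e' -> bounded H e -> bounded H' e' ->
    vnorm (pow_d2 x A H H' k) <= (e / d) * (e' / d) * X.
  move=> e0 e0' He He'; apply: le_trans (pow_d2_bound x rho0 d0 Arho k e0 e0' He He') _.
  by rewrite ler_wpM2l ?mulr_ge0// ?invr_ge0 ltW.
have XX : 0 <= X ^+ 2 by rewrite sqr_ge0.
have cs (u v : 'cV[R]_q) p p' : vnorm u <= p * X -> vnorm v <= p' * X ->
    `|dot u v| <= p * p' * X ^+ 2.
  move=> uX vX; apply: le_trans (normr_dot_le u v) _.
  by rewrite expr2 mulrACA ler_pM ?vnorm_ge0.
have aX1 : vnorm a <= 1 * X by rewrite mul1r.
have K0' := ltW K0.
split=> [j|i j|h hr].
- rewrite normrM gtr0_norm//.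
  have := cs _ _ _ _ aX1 (bX _ _ K0' (UK j)); rewrite -/c mul1r => h1.
  have h2 : 2 * c <= 10 * (1 + c) ^+ 3 by have := sqr_ge0 c; nra.
  by have := ler_wpM2r XX h2; lra.
- apply: le_trans (ler_normD _ _) _; rewrite normrM gtr0_norm//.
  have := cs _ _ _ _ aX1 (cX _ _ _ _ K0' K0' (UK i) (UK j)); rewrite -/c mul1r => h1.
  have := cs _ _ _ _ (bX _ _ K0' (UK i)) (bX _ _ K0' (UK j)); rewrite -/c => h2.
  have h3 : 3 * (c * c) <= 10 * (1 + c) ^+ 3 by have := sqr_ge0 c; nra.
  by have := ler_wpM2r XX h3; lra.
pose e := K * `|h|; pose H := Amat U h.
have e0 : 0 <= e by rewrite mulr_ge0.
have ed : e <= d by rewrite /e mulrC -ler_pdivlMr.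
have He : bounded H e := AK h.
have ed0 : 0 <= e / d by rewrite divr_ge0// ltW.
have ed1 : 0 <= e / d <= 1 by rewrite ed0 ler_pdivrMr// mul1r.
have rX : vnorm (pow_rem x A H k) <= (e / d) ^+ 3 * X.
  by apply: pow_rem_bound; rewrite ?e0.
have := sqr_pow_taylor ed1 X0 aX (bX _ _ e0 He) (cX _ _ _ _ e0 e0 He He) rX.
have -> : a + pow_d1 x A H k + pow_d2 x A H H k + pow_rem x A H k =
    Amat U (tau + h) ^+ k *m x.
  by rewrite AmatD /pow_rem -/A -/H -/a; apply/colP => i; rewrite !mxE; ring.
rewrite -/(sqpow _ k) -/(sqpow A k) => h1.
have -> : lin (fun j => 2 * dot a (pow_d1 x A (U j) k)) h = 2 * dot a (pow_d1 x A H k).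
  rewrite /H /Amat pow_d1_sum dot_sumr mulr_sumr; apply: eq_bigr => j _.
  by rewrite dotZr mulrCA.
have -> : quad (fun i j => dot (pow_d1 x A (U i) k) (pow_d1 x A (U j) k) +
    2 * dot a (pow_d2 x A (U i) (U j) k)) h =
    dot (pow_d1 x A H k) (pow_d1 x A H k) + 2 * dot a (pow_d2 x A H H k).
  rewrite /H /Amat pow_d2_sum pow_d1_sum dot_sumr.
  rewrite [X in _ = X + _](_ : _ = \sum_i \sum_j h 0 i * h 0 j *
     dot (pow_d1 x A (U i) k) (pow_d1 x A (U j) k)); last first.
    rewrite exchange_big; apply: eq_bigr => j _.
    rewrite dotC dot_sumr; apply: eq_bigr => i _.
    by rewrite dotZr dotC dotZr mulrA.
  rewrite dot_sumr mulr_sumr -big_split; apply: eq_bigr => i _ /=.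
  rewrite dot_sumr mulr_sumr -big_split; apply: eq_bigr => j _ /=.
  by rewrite dotZr; ring.
apply: le_trans h1 _; rewrite -[leRHS]mulrA ler_pM2l//.
rewrite [leRHS]mulrAC ler_wpM2r//.
have -> : e / d = c * `|h| by rewrite /e /c mulrAC.
rewrite [leLHS]exprMn ler_wpM2r ?exprn_ge0//.
by rewrite lerXn2r ?nnegrE ?addr_ge0// lerDr.
Qed.

End PhiSeries.

(** * Partial derivatives read off from expansions *)

Section ConverseTaylor.
Variable R : realType.

Lemma derive_eq (V : normedModType R) (g : V -> R) (a v : V) (L c d : R) :
  0 < d -> 0 <= c ->
  (forall s, s != 0 -> `|s| <= d -> `|g (a + s *: v) - g a - s * L| <= c * `|s| ^+ 2) ->
  derive g a v = L.
Proof.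
move=> d0 c0 gL; rewrite /derive; apply: cvg_lim => //.
apply/cvgrPdist_le => e e0; near=> s.
have s0 : s != 0 by near: s; exact: nbhs_dnbhs_neq.
have sd : `|s| <= d by near: s; exact: dnbhs0_le.
have se : `|s| <= e / (c + 1).
  by near: s; apply: dnbhs0_le; rewrite divr_gt0// ltr_wpDl.
have -> : L - s^-1 *: (g (s *: v + a) - g a) =
    - (s^-1 * (g (a + s *: v) - g a - s * L)).
  by rewrite [s *: v + a]addrC mulrBr mulKf// opprB.
rewrite normrN normrM normfV ler_pdivrMl ?normr_gt0//.
apply: le_trans (gL s s0 sd) _; rewrite expr2 mulrCA ler_wpM2l//.
rewrite ler_pdivlMr ?ltr_wpDl// in se; apply: le_trans _ se.
by rewrite mulrC ler_wpM2l// lerDl.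
Unshelve. all: by end_near. Qed.

Variable m : nat.
Implicit Types (f : 'rV[R]_m -> R) (tau th h : 'rV[R]_m).
Implicit Types (l : 'I_m -> R) (b : 'I_m -> 'I_m -> R).

Lemma linE l h : lin l h = (h *m \col_j l j) 0 0.
Proof. by rewrite mxE; apply: eq_bigr => j _; rewrite mxE. Qed.

Lemma quadE b h : quad b h = (h *m (\matrix_(i, j) b i j) *m h^T) 0 0.
Proof.
rewrite mxE /quad exchange_big; apply: eq_bigr => j _; rewrite !mxE mulr_suml.
by apply: eq_bigr => i _; rewrite mxE mulrAC.
Qed.

Lemma linZ l (s : R) h : lin l (s *: h) = s * lin l h.
Proof. by rewrite !linE -scalemxAl mxE. Qed.

Lemma quadZ b (s : R) h : quad b (s *: h) = s ^+ 2 * quad b h.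
Proof. by rewrite !quadE linearZ /= -!scalemxAl -scalemxAr scalerA mxE expr2. Qed.

Lemma lin_ej2 l (s s' : R) i j : lin l (s *: ej R i + s' *: ej R j) = s * l i + s' * l j.
Proof.
rewrite linE mulmxDl -!scalemxAl -!rowE.
by rewrite 3![in LHS]mxE [in LHS](mxE _ _ 0) !mxE.
Qed.

Lemma quad_ej2 b (s s' : R) i j : quad b (s *: ej R i + s' *: ej R j) =
  s ^+ 2 * b i i + s * s' * (b i j + b j i) + s' ^+ 2 * b j j.
Proof.
have dE k k' : (ej R k *m (\matrix_(i, j) b i j) *m (ej R k')^T) 0 0 = b k k'.
  by rewrite /ej trmx_delta -rowE -colE !mxE.
rewrite quadE linearD /= !linearZ /= !mulmxDl !mulmxDr -!scalemxAl -!scalemxAr.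
have DE (X Y : 'M[R]_1) : (X + Y) 0 0 = X 0 0 + Y 0 0 by rewrite mxE.
have ZE (a : R) (X : 'M[R]_1) : (a *: X) 0 0 = a * X 0 0 by rewrite mxE.
by rewrite !(DE, ZE) !dE; ring.
Qed.

Lemma normr_ej (j : 'I_m) : `|ej R j| <= 1.
Proof.
rewrite [leLHS]mx_normrE; apply/bigmax_leP; split=> // -[i k] _ /=.
by rewrite mxE; case: (_ && _); rewrite ?normr1 ?normr0.
Qed.

Lemma normr_ej2 (s s' : R) (i j : 'I_m) : `|s *: ej R i + s' *: ej R j| <= `|s| + `|s'|.
Proof.
apply: le_trans (ler_normD _ _) _.
by rewrite !normrZ lerD// ler_piMr// normr_ej.
Qed.

Lemma taylor2_pderiv f tau (r K : R) l b : 0 < r -> 0 <= K ->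
  (forall j, `|b j j| <= K) ->
  (forall h, `|h| <= r -> `|f (tau + h) - f tau - lin l h - quad b h| <= K * `|h| ^+ 3) ->
  forall j, pderiv f j tau = l j.
Proof.
move=> r0 K0 bK fK j.
(* For $|s| \le 1$ the quadratic term and the cubic error are each at most $K|s|^2$. *)
apply: (@derive_eq _ _ _ _ _ (K * 2) (Num.min r 1)) => [||s s0].
- by rewrite lt_min r0 ltr01.
- by rewrite mulr_ge0.
rewrite le_min => /andP[sr s1].
have hE : s *: ej R j = s *: ej R j + 0 *: ej R j by rewrite scale0r addr0.
have hs : `|s *: ej R j| <= `|s| by rewrite normrZ ler_piMr// normr_ej.
have := fK _ (le_trans hs sr); rewrite {2 3}hE lin_ej2 quad_ej2.
rewrite !mul0r mulr0 expr0n /= !mul0r !addr0 => h1.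
have h2 : `|s ^+ 2 * b j j| <= K * `|s| ^+ 2.
  by rewrite normrM normrX mulrC ler_wpM2r ?exprn_ge0.
have h3 : K * `|s *: ej R j| ^+ 3 <= K * `|s| ^+ 2.
  rewrite ler_wpM2l//; apply: (@le_trans _ _ (`|s| ^+ 3)).
    by rewrite lerXn2r ?nnegrE.
  by rewrite ler_wiXn2l.
have -> : f (tau + s *: ej R j) - f tau - s * l j =
  (f (tau + s *: ej R j) - f tau - s * l j - s ^+ 2 * b j j) + s ^+ 2 * b j j by ring.
apply: le_trans (ler_normD _ _) _; rewrite mulr_natr mulr2n mulrDl lerD//.
exact: le_trans h1 h3.
Qed.

(** The values at $\theta + s e_i \pm s e_j$ are expanded both at $\theta$ and at $\theta + s e_i$.
    In their difference the terms even in the second step cancel, leaving $2s\,l'_j$ against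
    $2s\,(l_j + s(b_{ij} + b_{ji}))$ up to cubic errors. *)
Lemma taylor2_hessian f th (r K : R) : 0 < r -> 0 <= K ->
  (forall tau, `|tau - th| <= r -> taylor2 f tau r K) ->
  exists l b,
  [/\ forall j, pderiv f j th = l j,
      forall i j, hessian f th i j = b i j + b j i &
      forall h, `|h| <= r -> `|f (th + h) - f th - lin l h - quad b h| <= K * `|h| ^+ 3].
Proof.
move=> r0 K0 fT.
have /fT[l [b [lK bK fK]]] : `|th - th| <= r by rewrite subrr normr0 ltW.
exists l, b; split=> //; first exact: (taylor2_pderiv r0 K0 (fun j => bK j j) fK).
move=> i j; rewrite mxE.
(* The four errors amount to $8+8+1+1 = 18$ times $K|s|^3$; division by $2|s|$ gives 9. The radius
   [r / 2] ensures $2|s| \le r$. *)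
rewrite [LHS](@derive_eq _ _ _ _ (b i j + b j i) (K * 9) (r / 2))//.
- by rewrite divr_gt0.
- by rewrite mulr_ge0.
move=> s s0 sr.
rewrite (taylor2_pderiv r0 K0 (fun j => bK j j) fK).
have sr' : `|s| <= r by lra.
have hs (k : 'I_m) : `|s *: ej R k| <= `|s| by rewrite normrZ ler_piMr// normr_ej.
have /fT[l' [b' [lK' bK' fK']]] : `|th + s *: ej R i - th| <= r.
  by rewrite addrAC subrr add0r (le_trans (hs i)).
rewrite (taylor2_pderiv r0 K0 (fun j => bK' j j) fK').
have ejE (a : R) : a *: ej R j = 0 *: ej R j + a *: ej R j by rewrite scale0r add0r.
have bd (a c : R) : `|a| + `|c| <= r ->
    `|f (th + (a *: ej R i + c *: ej R j)) - f th - (a * l i + c * l j) -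
      (a ^+ 2 * b i i + a * c * (b i j + b j i) + c ^+ 2 * b j j)| <=
    K * (`|a| + `|c|) ^+ 3.
  move=> acr; have := fK _ (le_trans (normr_ej2 a c i j) acr).
  rewrite lin_ej2 quad_ej2 => /le_trans; apply; rewrite ler_wpM2l//.
  by rewrite lerXn2r ?nnegrE ?addr_ge0// normr_ej2.
have bd' (c : R) : `|c| <= r ->
    `|f (th + (s *: ej R i + c *: ej R j)) - f (th + s *: ej R i) - c * l' j -
      c ^+ 2 * b' j j| <= K * `|c| ^+ 3.
  move=> cr; rewrite addrA; have hc : `|c *: ej R j| <= `|c| by rewrite normrZ ler_piMr// normr_ej.
  have := fK' _ (le_trans hc cr); rewrite {2 3}ejE lin_ej2 quad_ej2.
  rewrite !mul0r expr0n /= !mul0r !add0r => /le_trans; apply; rewrite ler_wpM2l//.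
  by rewrite lerXn2r ?nnegrE.
have := bd s s; have := bd s (- s); have := bd' s sr'; have := bd' (- s).
rewrite !normrN => /(_ sr') h1 h2 h3 h4.
have ss : `|s| + `|s| <= r by lra.
move: (h3 ss) (h4 ss) h1 h2 => {h3 h4}.
rewrite !ler_norml => /andP[a1 a2] /andP[b1 b2] /andP[c1 c2] /andP[d1 d2].
have s_gt0 : 0 < `|s| by rewrite normr_gt0.
rewrite -ler_norml -(@ler_pM2l _ (2 * `|s|)) ?mulr_gt0//.
have -> : 2 * `|s| * `|l' j - l j - s * (b i j + b j i)| =
    `|2 * s * (l' j - l j - s * (b i j + b j i))|.
  by rewrite !normrM (@gtr0_norm _ 2).
have -> : 2 * `|s| * (K * 9 * `|s| ^+ 2) = 18 * (K * `|s| ^+ 3) by ring.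
have e8 : K * (`|s| + `|s|) ^+ 3 = 8 * (K * `|s| ^+ 3) by ring.
rewrite e8 in a1 a2 b1 b2.
rewrite ler_norml; apply/andP; split; lra.
Qed.

End ConverseTaylor.

(** * Resolvents and concavity of [phi] *)

Section Resolvent.
Variables (R : realType) (n : nat).
Implicit Types (J N : 'M[R]_n) (u v y X : 'cV[R]_n) (c s : R).

Lemma resolvent_unit J c s : s < c -> bounded J s -> (c%:M + J) \in unitmx.
Proof.
move=> sc Js; rewrite unitmxE unitfE -det_tr; apply/det0P => -[v v0 Mv].
have : (c%:M + J) *m v^T = 0 by rewrite -[LHS]trmxK trmx_mul trmxK Mv trmx0.
rewrite mulmxDl mul_scalar_mx => /eqP; rewrite addr_eq0 => /eqP e.
have := Js v^T; rewrite -[J *m _]opprK -e -scaleN1r scalerA vnormZ => h.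
have [/vnorm_eq0 vT0|nv0] := eqVneq (vnorm v^T) 0.
  by move: v0; rewrite -[v]trmxK vT0 trmx0 eqxx.
have vp : 0 < vnorm v^T by rewrite lt_neqAle eq_sym nv0 vnorm_ge0.
move: h; rewrite ler_pM2r// mulN1r normrN => h.
by have := le_lt_trans (le_trans (ler_norm c) h) sc; rewrite ltxx.
Qed.

Lemma resolvent_ge0 J c s u : s <= c -> bounded J s -> 0 <= dot ((c%:M + J) *m u) u.
Proof.
move=> sc Js; rewrite mulmxDl mul_scalar_mx dotDl dotZl.
have := normr_dot_le (J *m u) u; rewrite ler_norml => /andP[h _].
have := ler_wpM2r (vnorm_ge0 u) (Js u).
have := ler_wpM2r (dot_ge0 u) sc; rewrite -sqr_vnorm; nra.
Qed.

(* [dot X y] is the maximum of [2 * dot X v - dot (M *m v) v] over [v]. *)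
Lemma resolvent_variational (M : 'M[R]_n) X y v : M^T = M ->
  (forall u, 0 <= dot (M *m u) u) -> M *m y = X ->
  2 * dot X v - dot (M *m v) v <= dot X y.
Proof.
move=> MT M0 My; have := M0 (v - y).
rewrite mulmxBr !(dotDl, dotDr, dotNl, dotNr) My (dotC (M *m v) y).
have -> : dot y (M *m v) = dot X v by rewrite -My dot_mulmxl MT.
lra.
Qed.

(* The perturbations [N] and [- N] are tested with [y - u] and [y + u],
   where [u = N *m y / (2 c)]. *)
Lemma resolvent_midpoint J N c s X y y1 y2 : J^T = J -> N^T = N -> 0 <= s < c ->
  bounded J s -> bounded (J + N) s -> bounded (J - N) s ->
  (c%:M + J) *m y = X -> (c%:M + (J + N)) *m y1 = X -> (c%:M + (J - N)) *m y2 = X ->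
  dot (N *m y) (N *m y) <= c * (dot X y1 + dot X y2 - 2 * dot X y).
Proof.
move=> JT NT /andP[s0 sc] Js JNs JNs' ey ey1 ey2.
have c0 : 0 < c by exact: le_lt_trans sc.
have symM (B : 'M[R]_n) : B^T = B -> (c%:M + B)^T = c%:M + B.
  by move=> BT; rewrite linearD /= tr_scalar_mx BT.
have T1 : (c%:M + (J + N))^T = c%:M + (J + N) by rewrite symM// linearD /= JT NT.
have T2 : (c%:M + (J - N))^T = c%:M + (J - N).
  by rewrite symM// linearD /= linearN /= JT NT.
have p1 u := resolvent_ge0 u (ltW sc) JNs.
have p2 u := resolvent_ge0 u (ltW sc) JNs'.
set w := N *m y; set eta := (2 * c)^-1.
have v1 := resolvent_variational (y - eta *: w) T1 p1 ey1.
have v2 := resolvent_variational (y + eta *: w) T2 p2 ey2.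
(* Since $\|J\| \le s < c$, the form of $c + J$ is at most $2c$; with $\eta = 1/(2c)$ the gain
   $4\eta - 4c\eta^2$ is then $1/c$. *)
have up : dot ((c%:M + J) *m w) w <= 2 * c * dot w w.
  rewrite mulmxDl mul_scalar_mx dotDl dotZl.
  have h1 := le_trans (ler_norm _) (normr_dot_le (J *m w) w).
  have h2 := ler_wpM2r (vnorm_ge0 w) (Js w).
  by have := ler_wpM2r (dot_ge0 w) (ltW sc); rewrite -sqr_vnorm; nra.
have e2c : eta * (2 * c) = 1 by rewrite mulVf// mulf_neq0// lt0r_neq0.
have eta0 : 0 <= eta by rewrite invr_ge0 mulr_ge0// ltW.
have NwE : dot (N *m w) y = dot w w by rewrite dot_mulmxl NT.
have XE : dot ((c%:M + J) *m w) y = dot X w.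
  by rewrite dot_mulmxl symM// ey dotC.
have XE' : dot ((c%:M + J) *m y) w = dot X w by rewrite ey.
have Xy : dot ((c%:M + J) *m y) y = dot X y by rewrite ey.
have NyE : dot (N *m y) y = dot w y by [].
(* Adding both tests cancels everything odd in the sign of the perturbation; what $\pm N$
   contributes is $4\eta\langle Ny, w\rangle = 4\eta|w|^2$. *)
have sum_le : 4 * eta * dot w w - 2 * eta ^+ 2 * dot ((c%:M + J) *m w) w <=
    dot X y1 + dot X y2 - 2 * dot X y.
  move: v1 v2; rewrite !addrA !(mulmxDl (c%:M + J)) !mulNmx !(mulmxDr _ y) !mulmxN.
  rewrite -!scalemxAr -/w.
  rewrite !(dotDl, dotDr, dotNl, dotNr, dotZl, dotZr) XE XE' Xy NwE.
  rewrite (dotC X y); lra.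
apply: le_trans (ler_wpM2l (ltW c0) sum_le).
have ceta : c * eta = 2^-1.
  by rewrite -[c in LHS](mulKf (_ : 2 != 0 :> R))// -mulrA (mulrC _ eta) e2c mulr1.
have h := ler_wpM2l (_ : 0 <= c * (2 * eta ^+ 2)) up.
have c2 : 0 <= c * (2 * eta ^+ 2) by rewrite !mulr_ge0 ?exprn_ge0// ltW.
move: (h c2).
have -> : c * (2 * eta ^+ 2) * (2 * c * dot w w) = (c * eta) ^+ 2 * 4 * dot w w by ring.
have -> : c * (4 * eta * dot w w - 2 * eta ^+ 2 * dot ((c%:M + J) *m w) w) =
  (c * eta) * 4 * dot w w - c * (2 * eta ^+ 2) * dot ((c%:M + J) *m w) w by ring.
rewrite ceta; lra.
Qed.

End Resolvent.

(** * The real form of $iA$ and its resolvent *)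

Section SkewSymmetric.
Variables (R : realType) (q : nat) (x : 'cV[R]_q).
Implicit Types (A B : 'M[R]_q).

(* Real form of the Hermitian matrix [i A]. *)
Definition sym_of A : 'M[R]_(q + q) := block_mx 0 A (- A) 0.

Definition xcol : 'cV[R]_(q + q) := col_mx x 0.

(** For $c = c_n$ this is $y_n$ of the overview, and [res_val] is $g_n$. *)
Definition res_sol c A : 'cV[R]_(q + q) := invmx (c%:M + sym_of A) *m xcol.

Definition res_val c A : R := c * dot xcol (res_sol c A).

Lemma dot_col_mx (a b a' b' : 'cV[R]_q) :
  dot (col_mx a b) (col_mx a' b') = dot a a' + dot b b'.
Proof. by rewrite /dot tr_col_mx mul_row_col mxE. Qed.

Lemma sym_ofD A B : sym_of (A + B) = sym_of A + sym_of B.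
Proof. by rewrite /sym_of add_block_mx !addr0 opprD. Qed.

Lemma sym_ofN A : sym_of (- A) = - sym_of A.
Proof. by rewrite /sym_of opp_block_mx !oppr0. Qed.

Lemma sym_ofZ a A : sym_of (a *: A) = a *: sym_of A.
Proof. by rewrite /sym_of scale_block_mx !scaler0 scalerN. Qed.

Lemma tr_sym_of A : A^T = - A -> (sym_of A)^T = sym_of A.
Proof. by move=> AT; rewrite /sym_of tr_block_mx !trmx0 linearN /= AT opprK. Qed.

Lemma bounded_sym_of A s : 0 <= s -> bounded A s -> bounded (sym_of A) s.
Proof.
move=> s0 As u; rewrite -[u]vsubmxK; set a := usubmx u; set b := dsubmx u.
rewrite /sym_of mul_block_col !mul0mx add0r addr0.
rewrite -(@ler_pXn2r _ 2)// ?nnegrE ?mulr_ge0 ?vnorm_ge0//.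
rewrite exprMn !sqr_vnorm !dot_col_mx mulNmx dotNl dotNr opprK -!sqr_vnorm.
have h v : vnorm (A *m v) ^+ 2 <= s ^+ 2 * vnorm v ^+ 2.
  by rewrite -exprMn lerXn2r ?nnegrE ?mulr_ge0 ?vnorm_ge0.
by rewrite mulrDr addrC lerD.
Qed.

Lemma res_solE c s A : 0 <= s < c -> bounded A s -> (c%:M + sym_of A) *m res_sol c A = xcol.
Proof.
move=> /andP[s0 sc] As; rewrite /res_sol mulKVmx//.
by apply: resolvent_unit sc _; exact: bounded_sym_of.
Qed.

(** This admits a solution that was found for another matrix, as happens in [phi_affine]. *)
Lemma res_val_unique c s A y : 0 <= s < c -> bounded A s ->
  (c%:M + sym_of A) *m y = xcol -> res_val c A = c * dot xcol y.
Proof.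
move=> /andP[s0 sc] As ey; rewrite /res_val /res_sol -ey mulKmx//.
by apply: resolvent_unit sc _; exact: bounded_sym_of.
Qed.

Lemma res_val_midpoint c s A B : A^T = - A -> B^T = - B -> 0 <= s < c ->
  bounded A s -> bounded (A + B) s -> bounded (A - B) s ->
  vnorm (sym_of B *m res_sol c A) ^+ 2 <=
  res_val c (A + B) + res_val c (A - B) - 2 * res_val c A.
Proof.
move=> AT BT s0c As ABs ABs'; have /andP[s0 _] := s0c.
have e0 := res_solE s0c As; have e1 := res_solE s0c ABs; have e2 := res_solE s0c ABs'.
rewrite /res_val sqr_vnorm mulrCA -mulrDr -mulrBr.
apply: (resolvent_midpoint (tr_sym_of AT) (tr_sym_of BT) s0c _ _ _ e0).
- exact: bounded_sym_of.
- by rewrite -sym_ofD; exact: bounded_sym_of.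
- by rewrite -sym_ofN -sym_ofD; exact: bounded_sym_of.
- by rewrite -sym_ofD.
- by rewrite -sym_ofN -sym_ofD.
Qed.

(** Neumann series: eliminating the second block, $z = c\,y_1$ satisfies $z = x + c^{-2}Sz$.
    Iterating $N$ times leaves the remainder $c^{-2N}\langle x, S^N z\rangle$, which decays like
    $(s/c)^{2N}$. *)
Lemma cvg_res_val c s A : A^T = - A -> 0 <= s < c -> bounded A s ->
  \sum_(k < N) c ^- k.*2 * sqpow x A k @[N --> \oo] --> res_val c A.
Proof.
move=> AT s0c As; have := res_solE s0c As; have /andP[s0 sc] := s0c.
have c0 : 0 < c := le_lt_trans s0 sc; have cn0 := lt0r_neq0 c0.
rewrite /res_val; set y := res_sol c A; rewrite -[y]vsubmxK.
set y1 := usubmx y; set y2 := dsubmx y.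
rewrite mulmxDl mul_scalar_mx scale_col_mx /sym_of mul_block_col !mul0mx add0r addr0.
rewrite add_col_mx => /eq_col_mx[e1 e2]; pose z := c *: y1; pose S := - (A *m A).
have zE : z = x + c ^- 2 *: (S *m z).
  have y2E : y2 = c^-1 *: (A *m y1).
    apply: (scalerI cn0); rewrite scalerA divff// scale1r.
    by apply/eqP; rewrite -subr_eq0 -mulNmx e2.
  rewrite -e1 y2E /S /z mulNmx -mulmxA -!scalemxAr scalerN !scalerA.
  by rewrite expr2 invfM -mulrA mulVf// mulr1 addrK.
have -> : c * dot xcol (col_mx y1 y2) = dot x z.
  by rewrite /xcol dot_col_mx (dotC 0) dot0r addr0 /z dotZr.
have partE N : dot x z = \sum_(k < N) c ^- k.*2 * sqpow x A k +
    c ^- N.*2 * dot x (S ^+ N *m z).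
  elim: N => [|N IH]; first by rewrite big_ord0 add0r double0 !expr0 invr1 mul1r mul1mx.
  rewrite IH big_ord_recr /= -addrA; congr (_ + _).
  rewrite [in LHS]zE mulmxDr dotDr -(dot_opp_sqr_pow x N AT) -/S mulrDr; congr (_ + _).
  by rewrite -scalemxAr dotZr mulmxA mulmxE -exprSr mulrA -invfM -exprD addn2.
pose r := (s / c) ^+ 2.
have r01 : 0 <= r < 1.
  rewrite exprn_ge0 ?divr_ge0// ?ltW//= expr_lt1 ?divr_ge0 ?(ltW c0)//.
  by rewrite ltr_pdivrMr// mul1r.
have /andP[r0 r1] := r01.
have bnd N : `|c ^- N.*2 * dot x (S ^+ N *m z)| <= vnorm x * vnorm z * r ^+ N.
  have Ss : bounded S (s * s) by apply/boundedN/boundedM.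
  have h := boundedX N (mulr_ge0 s0 s0) Ss z.
  rewrite normrM ger0_norm ?invr_ge0 ?exprn_ge0 ?(ltW c0)//.
  have h2 := le_trans (normr_dot_le x (S ^+ N *m z)) (ler_wpM2l (vnorm_ge0 x) h).
  have ci : 0 <= c ^- N.*2 by rewrite invr_ge0 exprn_ge0// ltW.
  apply: le_trans (ler_wpM2l ci h2) _; rewrite le_eqVlt; apply/orP; left; apply/eqP.
  by rewrite /r -mul2n exprM expr_div_n expr_div_n -expr2; ring.
have rem0 : c ^- N.*2 * dot x (S ^+ N *m z) @[N --> \oo] --> (0 : R).
  apply/cvgrPdist_le => e e0.
  have : vnorm x * vnorm z * r ^+ N @[N --> \oo] --> vnorm x * vnorm z * 0.
    by apply: cvgMl_tmp; apply: cvg_expr; rewrite ger0_norm.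
  rewrite mulr0 => /cvgrPdist_le/(_ e e0); apply: filterS => N.
  rewrite !sub0r !normrN; apply: le_trans; apply: le_trans (bnd N) _.
  exact: ler_norm.
have -> : (fun N => \sum_(k < N) c ^- k.*2 * sqpow x A k) =
    (fun N => dot x z - c ^- N.*2 * dot x (S ^+ N *m z)).
  by apply/funext => N; rewrite (partE N) addrK.
by rewrite -[X in _ --> X]subr0; apply: cvgB => //; exact: cvg_cst.
Qed.

End SkewSymmetric.

(** * Midpoint concavity and uniform expansion of [phi] *)

Section PhiConcavity.
Variables (R : realType) (q m : nat) (U : 'I_m -> 'M[R]_q).
Variables (x : 'cV[R]_q) (t : 'rV[R]_m).
Implicit Types (tau th h v : 'rV[R]_m) (A : 'M[R]_q).
Local Notation node := (node R).
Local Notation phi := (phi U x t).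

Lemma pi_le_node n : pi <= node n.
Proof. by rewrite /node ler_peMl ?ler1n// pi_ge0. Qed.

(** The sums over nodes and powers are exchanged by positivity: [b M k] is at most [a k] and tends
    to it. So [G M] stays below [F], and truncating the powers at a large [K] bounds it from
    below. *)
Lemma cvg_res_sum A s P : A^T = - A -> 0 <= s < pi -> bounded A s ->
  \sum_(k < N) cotc R k * sqpow x A k @[N --> \oo] --> P ->
  \sum_(n < M) 2 * (res_val x (node n) A - sqpow x A 0) @[M --> \oo] --> sqpow x A 0 - P.
Proof.
move=> AT /andP[s0 spi] As cP.
pose p k := sqpow x A k.+1; pose a k := - cotc R k.+1.
pose b M k := \sum_(n < M) 2 * node n ^- (k.+1).*2.
have p0 k : 0 <= p k by exact: dot_ge0.
set F := sqpow x A 0 - P; pose G M := \sum_(n < M) 2 * (res_val x (node n) A - sqpow x A 0).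
have cF : \sum_(k < N) a k * p k @[N --> \oo] --> F.
  have -> : (fun N => \sum_(k < N) a k * p k) =
      (fun N => sqpow x A 0 - \sum_(k < N.+1) cotc R k * sqpow x A k).
    apply/funext => N; rewrite big_ord_recl /= mul1r opprD addrA subrr add0r -sumrN.
    by apply: eq_bigr => k _; rewrite /a mulNr.
  by apply: cvgB; [exact: cvg_cst | rewrite -cvg_shiftS in cP].
have cG M : \sum_(k < N) b M k * p k @[N --> \oo] --> G M.
  have -> : (fun N => \sum_(k < N) b M k * p k) = (fun N => \sum_(n < M) 2 *
      (\sum_(k < N.+1) node n ^- k.*2 * sqpow x A k - sqpow x A 0)).
    apply/funext => N; under eq_bigr do rewrite /b mulr_suml.
    rewrite exchange_big; apply: eq_bigr => n _ /=.
    rewrite big_ord_recl /= double0 expr0 invr1 mul1r addrC addKr mulr_sumr.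
    by apply: eq_bigr => k _; rewrite mulrA.
  apply: cvg_sumr => n; apply: cvgMl_tmp; apply: cvgB; last exact: cvg_cst.
  have sn : 0 <= s < node n by rewrite s0 (lt_le_trans spi)// pi_le_node.
  by have := cvg_res_val (x := x) AT sn As; rewrite -cvg_shiftS.
have GF M : G M <= F.
  apply: (ler_cvg_to (cG M) cF); apply: nearW => N; apply: ler_sum => k _.
  by rewrite ler_wpM2r// node_sum_le.
have bG M K : \sum_(k < K) b M k * p k <= G M.
  apply: (cvgr_to_ge (cG M)); near=> N.
  have KN : (K <= N)%N by near: N; exact: nbhs_infty_ge.
  rewrite -!(big_mkord xpredT (fun k => b M k * p k)).
  rewrite [leRHS](@big_cat_nat _ _ _ K)//= lerDl sumr_ge0// => k _.
  rewrite mulr_ge0// sumr_ge0// => n _.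
  by rewrite mulr_ge0// invr_ge0 exprn_ge0// ltW// node_gt0.
apply/cvgrPdist_le => e e0; have e20 : 0 < e / 2 by rewrite divr_gt0.
have [K FK] : exists K, F - \sum_(k < K) a k * p k <= e / 2.
  have /cvgrPdist_le/(_ _ e20)[K _ hK] := cF.
  by exists K; apply: le_trans (ler_norm _) (hK K _) => /=.
have /cvgrPdist_le/(_ _ e20) : \sum_(k < K) b M k * p k @[M --> \oo] --> \sum_(k < K) a k * p k.
  by apply: cvg_sumr => k; apply: cvgMr_tmp; exact: cvg_node_sum.
apply: filterS => M /(le_trans (ler_norm _)) h.
rewrite -/(G M) ger0_norm ?subr_ge0 ?GF//.
by have := bG M K; lra.
Unshelve. all: by end_near. Qed.

Hypothesis Usk : forall j, (U j)^T = - U j.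

Let sq0 A A' : sqpow x A 0 = sqpow x A' 0.
Proof. by rewrite /sqpow !expr0. Qed.

(** The linear term drops out of the second difference, and each node contributes a nonnegative
    amount by [res_val_midpoint]; only the $n$-th one is kept. *)
Lemma phi_midpoint tau h n : Omega U tau -> Omega U (tau + h) -> Omega U (tau - h) ->
  2 * vnorm (sym_of (Amat U h) *m res_sol x (node n) (Amat U tau)) ^+ 2 <=
  2 * phi tau - phi (tau + h) - phi (tau - h).
Proof.
move=> O0 O1 O2.
have c0 := cvg_phi_series (x := x) (t := t) Usk O0.
have c1 := cvg_phi_series (x := x) (t := t) Usk O1.
have c2 := cvg_phi_series (x := x) (t := t) Usk O2.
move: O0 O1 O2 => /OmegaP[s0 [s00 s0p B0]] /OmegaP[s1 [s10 s1p B1]] /OmegaP[s2 [s20 s2p B2]].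
pose s := Num.max s0 (Num.max s1 s2).
have s01 : 0 <= s < pi by rewrite le_max s00 !gt_max s0p s1p s2p.
have {}B0 : bounded (Amat U tau) s by apply: bounded_le B0; rewrite le_max lexx.
have {}B1 : bounded (Amat U (tau + h)) s by apply: bounded_le B1; rewrite !le_max lexx orbT.
have {}B2 : bounded (Amat U (tau - h)) s by apply: bounded_le B2; rewrite !le_max lexx !orbT.
have sk th := Amat_skew th Usk.
have := cvg_res_sum (sk tau) s01 B0 c0.
have := cvg_res_sum (sk (tau + h)) s01 B1 c1.
have := cvg_res_sum (sk (tau - h)) s01 B2 c2.
rewrite (sq0 (Amat U (tau + h)) (Amat U tau)) (sq0 (Amat U (tau - h)) (Amat U tau)).
move=> r2 r1 r0.
have mid k : vnorm (sym_of (Amat U h) *m res_sol x (node k) (Amat U tau)) ^+ 2 <=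
    res_val x (node k) (Amat U (tau + h)) + res_val x (node k) (Amat U (tau - h)) -
    2 * res_val x (node k) (Amat U tau).
  have sn : 0 <= s < node k.
    by have /andP[-> /lt_le_trans->] := s01; rewrite ?pi_le_node.
  move: B1 B2; rewrite AmatD (AmatD U tau (- h)) AmatN => B1 B2.
  by apply: (res_val_midpoint x (sk tau) (sk h) sn).
have -> : 2 * phi tau - phi (tau + h) - phi (tau - h) =
    sqpow x (Amat U tau) 0 - (phi (tau + h) - 4 * \sum_j t 0 j * (tau + h) 0 j) +
    (sqpow x (Amat U tau) 0 - (phi (tau - h) - 4 * \sum_j t 0 j * (tau - h) 0 j)) -
    2 * (sqpow x (Amat U tau) 0 - (phi tau - 4 * \sum_j t 0 j * tau 0 j)).
  have -> : \sum_j t 0 j * (tau + h) 0 j = \sum_j t 0 j * tau 0 j + \sum_j t 0 j * h 0 j.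
    by rewrite -big_split; apply: eq_bigr => j _; rewrite mxE mulrDr.
  have -> : \sum_j t 0 j * (tau - h) 0 j = \sum_j t 0 j * tau 0 j - \sum_j t 0 j * h 0 j.
    by rewrite -sumrB; apply: eq_bigr => j _; rewrite !mxE mulrBr.
  by ring.
apply: (cvgr_to_ge (cvgB (cvgD r1 r2) (cvgMl_tmp (a := 2) r0))); near=> M.
have nM : (n < M)%N by near: M; exact: nbhs_infty_ge.
rewrite -[leRHS]/(_ + _ - 2 * _) mulr_sumr -big_split -sumrB /=.
rewrite (bigD1 (Ordinal nM))//= -[leLHS]addr0 lerD//.
  by have := mid n; lra.
rewrite sumr_ge0// => k _; have := mid k.
by have := sqr_ge0 (vnorm (sym_of (Amat U h) *m res_sol x (node k) (Amat U tau))); lra.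
Unshelve. all: by end_near. Qed.

(** The hypothesis makes $y_n$ a solution for $\tau + h$ as well, so no $g_n$ changes and only the
    linear term varies. *)
Lemma phi_affine tau h : Omega U tau -> Omega U (tau + h) ->
  (forall n, sym_of (Amat U h) *m res_sol x (node n) (Amat U tau) = 0) ->
  phi (tau + h) = phi tau + 4 * \sum_j t 0 j * h 0 j.
Proof.
move=> O0 O1 h0.
have c0 := cvg_phi_series (x := x) (t := t) Usk O0.
have c1 := cvg_phi_series (x := x) (t := t) Usk O1.
move: O0 O1 => /OmegaP[s0 [s00 s0p B0]] /OmegaP[s1 [s10 s1p B1]].
have r0 := cvg_res_sum (Amat_skew tau Usk) (introT andP (conj s00 s0p)) B0 c0.
have r1 := cvg_res_sum (Amat_skew (tau + h) Usk) (introT andP (conj s10 s1p)) B1 c1.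
have e : phi (tau + h) - 4 * \sum_j t 0 j * (tau + h) 0 j =
    phi tau - 4 * \sum_j t 0 j * tau 0 j.
  apply: oppr_inj; apply: (addrI (sqpow x (Amat U tau) 0)).
  rewrite (sq0 (Amat U (tau + h)) (Amat U tau)) in r1.
  rewrite (_ : (fun M => _) = (fun M => \sum_(n < M) 2 *
    (res_val x (node n) (Amat U tau) - sqpow x (Amat U tau) 0))) in r1.
    exact: (cvg_unique _ r1 r0).
  apply/funext => M; apply: eq_bigr => n _; congr (_ * (_ - _)).
  have sn0 : 0 <= s0 < node n by rewrite s00 (lt_le_trans s0p)// pi_le_node.
  have sn1 : 0 <= s1 < node n by rewrite s10 (lt_le_trans s1p)// pi_le_node.
  rewrite (res_val_unique (y := res_sol x (node n) (Amat U tau)) sn1 B1)//.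
  by rewrite AmatD sym_ofD addrA mulmxDl h0 addr0 (res_solE _ sn0 B0).
have -> : phi (tau + h) = phi tau - 4 * \sum_j t 0 j * tau 0 j +
    4 * \sum_j t 0 j * (tau + h) 0 j by rewrite -e subrK.
rewrite -addrA; congr (_ + _); rewrite -mulrN -mulrDr; congr (_ * _).
rewrite -sumrN -big_split; apply: eq_bigr => j _ /=; rewrite mxE; ring.
Qed.

Lemma Omega_segment tau v (a : R) : 0 <= a <= 1 -> Omega U tau -> Omega U (tau + v) ->
  Omega U (tau + a *: v).
Proof.
move=> /andP[a0 a1] /OmegaP[s0 [s00 s0p B0]] /OmegaP[s1 [s10 s1p B1]].
have a1' : 0 <= 1 - a by rewrite subr_ge0.
apply/OmegaP; exists (Num.max s0 s1); split; first by rewrite le_max s00.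
  by rewrite gt_max s0p.
have h0 := ler_wpM2l a1' (_ : s0 <= Num.max s0 s1).
have h1 := ler_wpM2l a0 (_ : s1 <= Num.max s0 s1).
apply: (@bounded_le _ _ _ ((1 - a) * s0 + a * s1)).
  by rewrite !le_max !lexx orbT in h0 h1; have := h0 isT; have := h1 isT; lra.
have -> : tau + a *: v = (1 - a) *: tau + a *: (tau + v).
  by rewrite scalerBl scale1r scalerDr addrA subrK.
rewrite AmatD !AmatZ; apply: boundedD.
  by rewrite -{2}(ger0_norm a1'); exact: boundedZ.
by rewrite -{2}(ger0_norm a0); exact: boundedZ.
Qed.

Lemma taylor2_phi th : Omega U th -> exists r K, [/\ 0 < r, 0 <= K,
  forall tau, `|tau - th| <= r -> taylor2 phi tau r K &
  forall tau, `|tau - th| <= r -> Omega U tau].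
Proof.
move=> /OmegaP[s [s0 spi Bs]]; have [K0 [K00 UK AK]] := Amat_bounded U.
(* Moving the base point costs one [d] and the majorant of [taylor2_sqpow] two more; a quarter of
   the room keeps $s + 3d < \pi$. *)
pose d := (pi - s) / 4; have d0 : 0 < d by rewrite divr_gt0// subr_gt0.
have dpi : s + d *+ 4 = pi by rewrite /d -mulr_natr divfK// addrC subrK.
have r0 : 0 < d / K0 by rewrite divr_gt0.
have dd0 := ltW d0.
have near_bounded tau : `|tau - th| <= d / K0 -> bounded (Amat U tau) (s + d).
  move=> tr; rewrite -[tau](subrK th) addrC AmatD; apply: boundedD => //.
  by apply: bounded_le (AK _); rewrite mulrC -ler_pdivlMr.
have sd0 : 0 <= s + d by rewrite addr_ge0.
pose C := 10 * (1 + K0 / d) ^+ 3 * vnorm x ^+ 2.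
have C0 : 0 <= C by rewrite !mulr_ge0 ?exprn_ge0 ?vnorm_ge0// addr_ge0// divr_ge0// ltW.
pose z := (s + d + d *+ 2) ^+ 2 / pi ^+ 2 : R.
have z01 : 0 <= z < 1.
  apply: pi_ratio; rewrite !addr_ge0 ?mulrn_wge0//= -dpi; lra.
exists (d / K0), (4 * C / (1 - z) + \sum_j `|4 * t 0 j|).
have z1 : 0 < 1 - z by rewrite subr_gt0; case/andP: z01.
split=> // [|tau tr|tau tr].
- by rewrite addr_ge0 ?sumr_ge0// divr_ge0//; [rewrite mulr_ge0 | rewrite ltW].
- have -> : phi = (fun t' => (phi t' - 4 * \sum_j t 0 j * t' 0 j) +
      lin (fun j => 4 * t 0 j) t').
    apply/funext => t'; rewrite /lin mulr_sumr -addrA -sumrN -big_split big1 ?addr0//.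
    by move=> j _ /=; ring.
  apply: taylor2_add_lin.
  apply: (@taylor2_series _ _ (fun k t' => cotc R k * sqpow x (Amat U t') k)) => //.
  + exact: ltW.
  + by rewrite mulr_ge0.
  + move=> k; apply: taylor2_le; last first.
      apply: taylor2Z; apply: (taylor2_sqpow x k K00 sd0 d0 UK AK).
      exact: near_bounded.
    rewrite -/C; set B := C * _.
    have B0 : 0 <= B by rewrite mulr_ge0// exprn_ge0// sqr_ge0.
    rewrite -[B in leLHS](ger0_norm B0) -normrM.
    by apply: cotc_pow_le; rewrite ger0_norm.
  move=> h hr; apply: cvg_phi_series => //; apply/OmegaP.
  exists (s + d + d); split; [by rewrite addr_ge0 | by rewrite -dpi; lra |].
  rewrite AmatD; apply: boundedD; first exact: near_bounded.
  by apply: bounded_le (AK _); rewrite mulrC -ler_pdivlMr.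
apply/OmegaP; exists (s + d); split=> //; [by rewrite -dpi; lra | exact: near_bounded].
Qed.

End PhiConcavity.

(** * Maximizers *)

Section LocalMaximum.
Variables (R : realType) (m : nat) (f : 'rV[R]_m -> R) (th : 'rV[R]_m) (r K : R).
Variables (l : 'I_m -> R) (b : 'I_m -> 'I_m -> R).
Hypotheses (r0 : 0 < r) (K0 : 0 <= K)
  (fT : forall h, `|h| <= r -> `|f (th + h) - f th - lin l h - quad b h| <= K * `|h| ^+ 3).
Implicit Types (v w : 'rV[R]_m).

Lemma taylor_line v : exists d C, [/\ 0 < d, 0 <= C & forall e, `|e| <= d ->
  `|e *: v| <= r /\
  `|f (th + e *: v) - f th - e * lin l v - e ^+ 2 * quad b v| <= C * `|e| ^+ 3].
Proof.
exists (r / (`|v| + 1)), (K * `|v| ^+ 3); split.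
- by rewrite divr_gt0// ltr_wpDl.
- by rewrite mulr_ge0// exprn_ge0.
move=> e; rewrite ler_pdivlMr ?ltr_wpDl// => er.
have evr : `|e *: v| <= r.
  by rewrite normrZ; apply: le_trans er; rewrite ler_wpM2l// lerDl.
split=> //; have := fT evr; rewrite linZ quadZ normrZ => /le_trans; apply.
by rewrite le_eqVlt; apply/orP; left; apply/eqP; ring.
Qed.

Lemma le0_linear_bound (a C d : R) : 0 < d ->
  (forall e, 0 < e <= d -> a <= C * e) -> a <= 0.
Proof.
move=> d0 aC; rewrite leNgt; apply/negP => a0.
(* This choice gives $Ce \le a/2 < a$. *)
pose e := Num.min d (a / (`|C| + 1) / 2).
have C1 : 0 < `|C| + 1 by rewrite ltr_wpDl.
have e0 : 0 < e by rewrite lt_min d0 !divr_gt0.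
have ed : e <= d by rewrite ge_min lexx.
have ea : e * (`|C| + 1) <= a / 2.
  by rewrite -ler_pdivlMr// mulrAC ge_min lexx orbT.
have := aC e; rewrite e0 ed => /(_ isT).
have := ler_wpM2r (ltW e0) (ler_norm C); nra.
Qed.

Hypothesis fmax : forall h, `|h| <= r -> f (th + h) <= f th.

Lemma max_lin0 v : lin l v = 0.
Proof.
have le0 w : lin l w <= 0.
  have [d [C [d0 C0 hT]]] := taylor_line w.
  (* After division by $e \le 1$, the quadratic term and the cubic error are both $O(e)$. *)
  apply: (@le0_linear_bound _ (C + `|quad b w|) (Num.min d 1)).
    by rewrite lt_min d0 ltr01.
  move=> e /andP[e0]; rewrite le_min => /andP[ed e1].
  have ee : `|e| = e by rewrite gtr0_norm.
  have ed' : `|e| <= d by rewrite ee.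
  have [wr] := hT e ed'; rewrite ee ler_norml => /andP[h _].
  have h2 := fmax wr; rewrite -(@ler_pM2l _ e)//.
  have h3 : C * e ^+ 3 <= C * e ^+ 2 by rewrite ler_wpM2l// ler_wiXn2l// ltW.
  have h4 : e ^+ 2 * - quad b w <= e ^+ 2 * `|quad b w|.
    by rewrite ler_wpM2l ?sqr_ge0// -normrN ler_norm.
  have -> : e * ((C + `|quad b w|) * e) = C * e ^+ 2 + e ^+ 2 * `|quad b w| by ring.
  lra.
apply/eqP; rewrite eq_le le0 /=.
by have := le0 (- v); rewrite -scaleN1r linZ; lra.
Qed.

Lemma max_quad_le0 v : quad b v <= 0.
Proof.
have [d [C [d0 C0 hT]]] := taylor_line v.
apply: (@le0_linear_bound _ C d d0) => e /andP[e0 ed].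
have ee : `|e| = e by rewrite gtr0_norm.
have ed' : `|e| <= d by rewrite ee.
have [vr] := hT e ed'; rewrite ee max_lin0 mulr0 subr0 ler_norml => /andP[h _].
have := fmax vr => h2; rewrite -(@ler_pM2l _ (e ^+ 2)) ?exprn_gt0//.
have -> : e ^+ 2 * (C * e) = C * e ^+ 3 by ring.
lra.
Qed.

End LocalMaximum.

Section QuadraticForm.
Variables (R : realType) (m : nat) (b : 'I_m -> 'I_m -> R).
Implicit Types (v w : 'rV[R]_m).

Let H : 'M[R]_m := \matrix_(i, j) (b i j + b j i).

Lemma quadD v w : quad b (v + w) = quad b v + quad b w + (v *m H *m w^T) 0 0.
Proof.
have HE : H = \matrix_(i, j) b i j + (\matrix_(i, j) b i j)^T.
  by apply/matrixP => i j; rewrite !mxE.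
rewrite !quadE HE linearD /= !mulmxDl !mulmxDr !mulmxDl; set B := \matrix_(i, j) b i j.
have -> : v *m B^T *m w^T = (w *m B *m v^T)^T by rewrite !trmx_mul trmxK mulmxA.
by rewrite !mxE; ring.
Qed.

(** At $v + ew$ the form is $e\,vHw^T$ plus $e^2$ times its value at $w$. Dividing by $e \to 0$
    gives $vHw^T \le 0$, and replacing $w$ by $-w$ gives equality. *)
Lemma quad_kernel v : (forall w, quad b w <= 0) -> quad b v = 0 -> v *m H = 0.
Proof.
move=> q0 qv; have b0 w : (v *m H *m w^T) 0 0 <= 0.
  apply: (@le0_linear_bound R _ (- quad b w) 1 ltr01) => e /andP[e0 _].
  have := q0 (v + e *: w); rewrite quadD qv add0r quadZ linearZ /= -scalemxAr.
  have -> : (e *: (v *m H *m w^T)) 0 0 = e * (v *m H *m w^T) 0 0 by rewrite mxE.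
  by move=> h; rewrite -(ler_pM2l e0); lra.
apply/rowP => j; rewrite [RHS]mxE; apply/eqP; rewrite eq_le.
have E w : w = delta_mx 0 j -> (v *m H *m w^T) 0 0 = (v *m H) 0 j.
  by move=> ->; rewrite trmx_delta -colE mxE.
have := b0 (- delta_mx 0 j); rewrite linearN /= mulmxN.
have -> (X : 'M[R]_1) : (- X) 0 0 = - X 0 0 by rewrite mxE.
rewrite E// oppr_le0 => ->; rewrite andbT.
by have := b0 (delta_mx 0 j); rewrite E.
Qed.

End QuadraticForm.

(** * Uniqueness of the maximizer against nondegeneracy of the Hessian *)

Section MaximizerNondegenerate.
Variables (R : realType) (q m : nat) (U : 'I_m -> 'M[R]_q).
Variables (x : 'cV[R]_q) (t : 'rV[R]_m).
Hypothesis Usk : forall j, (U j)^T = - U j.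
Implicit Types (tau th h v : 'rV[R]_m).
Local Notation phi := (phi U x t).

Lemma phi_dyadic th v n : Omega U th -> Omega U (th + v) ->
  2^-1 ^+ n * (phi (th + v) - phi th) <= phi (th + 2^-1 ^+ n *: v) - phi th.
Proof.
move=> O0 O1; elim: n => [|n IH]; first by rewrite expr0 mul1r scale1r.
set e := 2^-1 ^+ n.+1; have e2 : 2^-1 ^+ n = 2 * e :> R by rewrite /e exprS mulrA divff// mul1r.
have e01 k : 0 <= (2^-1 : R) ^+ k <= 1.
  by rewrite exprn_ge0// exprn_ile1// invf_le1// ler1n.
have Oe := Omega_segment (e01 n.+1) O0 O1; rewrite -/e in Oe.
have E1 : th + e *: v + e *: v = th + 2^-1 ^+ n *: v.
  by rewrite e2 -addrA -scalerDl mulr_natl mulr2n.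
have E2 : th + e *: v - e *: v = th by rewrite addrK.
(* Any node serves here, index 0 for instance, as only the sign of the second difference matters. *)
have := @phi_midpoint _ _ _ U x t Usk (th + e *: v) (e *: v) 0 Oe.
rewrite E1 E2 => /(_ (Omega_segment (e01 n) O0 O1) O0).
set w := vnorm _ ^+ 2; have w0 : 0 <= w by exact: sqr_ge0.
move: IH; rewrite e2; lra.
Qed.

Lemma cvg_half : 2^-1 ^+ n @[n --> \oo] --> (0 : R).
Proof. by apply: cvg_expr; rewrite ger0_norm// invf_lt1// ltr1n. Qed.

Lemma le0_dyadic_bound (a C d : R) : 0 < d ->
  (forall n, 2^-1 ^+ n <= d -> a <= C * 2^-1 ^+ n) -> a <= 0.
Proof.
move=> d0 aC; rewrite -(mulr0 C).
apply: (cvgr_to_ge (cvgMl_tmp (a := C) cvg_half)).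
have /cvgrPdist_le/(_ d d0) := cvg_half; apply: filterS => n.
by rewrite sub0r normrN ger0_norm ?exprn_ge0// => /aC.
Qed.

Lemma nondegenerate_unique_max th : Omega U th -> grad_zero phi th ->
  \det (hessian phi th) != 0 -> maximizers U x t = [set th].
Proof.
move=> Oth g0 dH; have [r [K [r0 K0 hT hO]]] := taylor2_phi x t Usk Oth.
have [l [b [lE bE hb]]] := taylor2_hessian r0 K0 hT.
have l0 v : lin l v = 0 by rewrite /lin big1// => j _; rewrite -lE g0 mulr0.
(* By concavity the increment over $v$ is at most $2^n$ times that over $2^{-n}v$, which is
   $O(2^{-n})$ at a critical point. *)
have max tau : Omega U tau -> phi tau <= phi th.
  rewrite -[tau](subrK th) addrC; move: (tau - th) => v Ov.
  have [d [C [d0 C0 line]]] := taylor_line r0 K0 hb v.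
  rewrite -subr_le0; apply: (@le0_dyadic_bound _ (C + `|quad b v|) d d0) => n nd.
  have e0 : 0 < 2^-1 ^+ n :> R by rewrite exprn_gt0.
  have ee : `|2^-1 ^+ n| = 2^-1 ^+ n :> R by rewrite gtr0_norm.
  have e1 : 2^-1 ^+ n <= 1 :> R by rewrite exprn_ile1// invf_le1// ler1n.
  have nd' : `|2^-1 ^+ n| <= d by rewrite ee.
  have := phi_dyadic n Oth Ov; move: (2^-1 ^+ n) e0 ee e1 nd' {nd} => e e0 ee e1 ed h1.
  have [_] := line e ed; rewrite l0 mulr0 subr0 ee ler_norml => /andP[_ h2].
  have h3 : C * e ^+ 3 <= C * e ^+ 2 by rewrite ler_wpM2l// ler_wiXn2l// ltW.
  have h4 : e ^+ 2 * quad b v <= e ^+ 2 * `|quad b v|.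
    by rewrite ler_wpM2l ?sqr_ge0// ler_norm.
  rewrite -(@ler_pM2l _ e)//.
  have -> : e * ((C + `|quad b v|) * e) = C * e ^+ 2 + e ^+ 2 * `|quad b v| by ring.
  lra.
apply/seteqP; split=> [tau [Ot mt]|_ ->]; last by split.
have pE : phi tau = phi th by apply/eqP; rewrite eq_le max// mt.
apply/eqP; rewrite -subr_eq0; apply: contraNT dH => v0.
move: Ot pE v0; rewrite -{1 2}[tau](subrK th) addrC; move: (tau - th) => v Ov pE v0.
have lmax h : `|h| <= r -> phi (th + h) <= phi th.
  by move=> hr; apply/max/hO; rewrite addrAC subrr add0r.
have q0 := max_quad_le0 r0 K0 hb lmax.
(* Concavity keeps [phi] at its maximal value towards the second maximizer, so the quadratic part
   along $v$ cannot be negative. *)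
have qv : quad b v = 0.
  apply/eqP; rewrite eq_le q0 /= -oppr_le0.
  have [d [C [d0 C0 line]]] := taylor_line r0 K0 hb v.
  apply: (@le0_dyadic_bound _ C d d0) => n nd.
  have e0 : 0 < 2^-1 ^+ n :> R by rewrite exprn_gt0.
  have ee : `|2^-1 ^+ n| = 2^-1 ^+ n :> R by rewrite gtr0_norm.
  have nd' : `|2^-1 ^+ n| <= d by rewrite ee.
  have := phi_dyadic n Oth Ov; rewrite pE subrr mulr0.
  move: (2^-1 ^+ n) e0 ee nd' {nd} => e e0 ee ed h1.
  have [_] := line e ed; rewrite l0 mulr0 subr0 ee ler_norml => /andP[_ h2].
  rewrite -(@ler_pM2l _ (e ^+ 2)) ?exprn_gt0//.
  have -> : e ^+ 2 * (C * e) = C * e ^+ 3 by ring.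
  lra.
apply/det0P; exists v => //.
have -> : hessian phi th = \matrix_(i, j) (b i j + b j i).
  by apply/matrixP => i j; rewrite bE mxE.
exact: quad_kernel.
Qed.

(** A kernel vector $v$ of the Hessian makes the second difference of [phi] along $v$ cubic in the
    step, which forces $J(v)y_n = 0$ for all $n$. Then [phi] is affine along $v$ with slope 0, and
    moving along $v$ yields a second maximizer. *)
Lemma unique_max_nondegenerate th : maximizers U x t = [set th] ->
  [/\ Omega U th, grad_zero phi th & \det (hessian phi th) != 0].
Proof.
move=> mE; have [Oth max] : maximizers U x t th by rewrite mE.
have [r [K [r0 K0 hT hO]]] := taylor2_phi x t Usk Oth.
have [l [b [lE bE hb]]] := taylor2_hessian r0 K0 hT.
have Oh h : `|h| <= r -> Omega U (th + h).
  by move=> hr; apply: hO; rewrite addrAC subrr add0r.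
have lmax h : `|h| <= r -> phi (th + h) <= phi th by move=> /Oh/max.
have l0 := max_lin0 r0 K0 hb lmax.
split=> //.
  by move=> j; rewrite lE -(l0 (ej R j)) linE -rowE !mxE.
apply/negP => /det0P[v v0 vH].
have HE : hessian phi th = \matrix_(i, j) (b i j + b j i).
  by apply/matrixP => i j; rewrite bE mxE.
(* At $2v$ the form is four times its value at $v$ by homogeneity, but only twice by [quadD]. *)
have qv : quad b v = 0.
  have := quadD b v v; rewrite -HE vH mul0mx mxE addr0 -mulr2n -scaler_nat quadZ.
  by rewrite expr2; lra.
have [d [C [d0 C0 line]]] := taylor_line r0 K0 hb v.
have nul n : sym_of (Amat U v) *m res_sol x (node R n) (Amat U th) = 0.
  apply/vnorm_eq0/eqP; rewrite -sqrf_eq0 eq_le sqr_ge0 andbT.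
  apply: (@le0_linear_bound R _ C d d0) => e /andP[e0 ed].
  have ee : `|e| = e by rewrite gtr0_norm.
  have ed1 : `|e| <= d by rewrite ee.
  have ed2 : `|- e| <= d by rewrite normrN.
  have [r1] := line e ed1; have [r2] := line (- e) ed2.
  rewrite !l0 !qv !mulr0 !subr0 normrN ee !ler_norml => /andP[h1 _] /andP[h2 _].
  rewrite scaleNr in r2 h1.
  have := phi_midpoint x t Usk n Oth (Oh _ r1) (Oh _ r2).
  rewrite AmatZ sym_ofZ -scalemxAl vnormZ ee exprMn => h3.
  rewrite -(@ler_pM2l _ (e ^+ 2)) ?exprn_gt0//.
  have -> : e ^+ 2 * (C * e) = C * e ^+ 3 by ring.
  lra.
have aff e : `|e| <= d -> phi (th + e *: v) = phi th + e * (4 * \sum_j t 0 j * v 0 j).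
  move=> ed; have [er _] := line e ed.
  rewrite (phi_affine t Usk Oth (Oh _ er)).
    congr (_ + _); rewrite [RHS]mulrCA; congr (_ * _); rewrite mulr_sumr.
    apply: eq_bigr => j _.
    by rewrite mxE mulrCA.
  by move=> n; rewrite AmatZ sym_ofZ -scalemxAl nul scaler0.
have dd : `|d| <= d by rewrite gtr0_norm.
have dd' : `|- d| <= d by rewrite normrN.
have [rd _] := line d dd; have [rd' _] := line (- d) dd'.
have := lmax _ rd; have := lmax _ rd'; rewrite !aff// => h1 h2.
(* Neither $\theta + dv$ nor $\theta - dv$ exceeds the maximum, so the slope vanishes. *)
have t0 : d * (4 * \sum_j t 0 j * v 0 j) = 0 by lra.
have : maximizers U x t (th + d *: v).
  by split; [exact: Oh | rewrite aff// t0 addr0].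
rewrite mE => /= /eqP; rewrite -subr_eq0 addrAC subrr add0r scaler_eq0 (negbTE v0).
by rewrite gt_eqF.
Qed.

End MaximizerNondegenerate.

Theorem theorem2p4 (R : realType) (q m : nat) (U : 'I_m -> 'M[R]_q) :
  (0 < q)%N -> (0 < m)%N ->
  (forall j, (U j)^T = - U j) ->
  (forall c : 'I_m -> R, \sum_j c j *: U j = 0 -> forall j, c j = 0) ->
  forall (x : 'cV[R]_q) (t : 'rV[R]_m), inM U x t <-> inM1 U x t.
Proof.
move=> _ _ Usk _ x t; split=> [[th Oth [g0 dH]]|[th mE]].
  by exists th; exact: nondegenerate_unique_max.
by have [Oth g0 dH] := unique_max_nondegenerate Usk mE; exists th.
Qed.
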